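(* Let $n\ge 1$ and let $$q(t_1,\dots,t_n)=\sum_{k_1,\dots,k_n\ge 0} a_{k_1,\dots,k_n}\,t_1^{k_1}\cdots t_n^{k_n},\qquad a_{0,\dots,0}=0,$$ be a polynomial in $n$ real variables with complex coefficients. Then there exists a random vector $(X_1,\dots,X_n)$ with characteristic function $\varphi(t_1,\dots,t_n)=\mathbb{E}\,e^{i(t_1X_1+\dots+t_nX_n)}$, whose components $X_1,\dots,X_n$ have characteristic functions $\varphi_1,\dots,\varphi_n$ respectively, such that $$\varphi(t_1,\dots,t_n)=\varphi_1(t_1)\cdots\varphi_n(t_n)\exp\big(q(t_1,\dots,t_n)\big)\quad\text{for all } t_1,\dots,t_n\in\mathbb{R},$$ if and only if the following two conditions hold: (i) $q$ contains no monomials depending on only one variable, i.e. $a_{k_1,\dots,k_n}=0$ whenever exactly one of $k_1,\dots,k_n$ is nonzero; (ii) for every multi-index $(k_1,\dots,k_n)$, the coefficient $a_{k_1,\dots,k_n}$ is real if $k_1+\dots+k_n$ is even, and purely imaginary (i.e. lies in $i\mathbb{R}$) if $k_1+\dots+k_n$ is odd.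
   Context: The characteristic function of a random vector $(X_1,\dots,X_n)$ is $\varphi(t_1,\dots,t_n)=\mathbb{E}\exp(i(t_1X_1+\dots+t_nX_n))$, and that of a random variable $X_j$ is $\varphi_j(t)=\mathbb{E}\exp(itX_j)$. (Random variables satisfying the displayed identity for some polynomial $q$ with $q(0,\dots,0)=0$ are called $Q$-independent.) *)

(* Defs.v *)
From HB Require Import structures.
From mathcomp Require Import all_boot all_order all_algebra.
From mathcomp Require Import all_classical all_reals all_analysis.
From mathcomp Require Import complex.
Set Implicit Arguments. Unset Strict Implicit. Unset Printing Implicit Defensive.
Import Order.TTheory GRing.Theory Num.Theory.
Local Open Scope ring_scope.
Local Open Scope complex_scope.

(* E exp(i Y) = E cos Y + i E sin Y, for a real random variable Y *)
Definition cf_of {d} {T : measurableType d} {R : realType}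
  (P : probability T R) (Y : T -> R) : R[i] :=
  Complex (Rintegral P setT (fun w => cos (Y w)))
          (Rintegral P setT (fun w => sin (Y w))).

Definition charfun_vec {d} {T : measurableType d} {R : realType}
  (P : probability T R) (n : nat) (X : 'I_n -> {RV P >-> R}) (t : 'I_n -> R) : R[i] :=
  cf_of P (fun w => \sum_(j < n) t j * X j w).

Definition charfun {d} {T : measurableType d} {R : realType}
  (P : probability T R) (Y : {RV P >-> R}) (s : R) : R[i] :=
  cf_of P (fun w => s * Y w).

Definition cexp {R : realType} (z : R[i]) : R[i] :=
  let: Complex x y := z in Complex (expR x * cos y) (expR x * sin y).

(* A polynomial in n variables of degree < D.+1 in each variable, given by its
   coefficients a_k, k ranging over multi-indices k : 'I_n -> 'I_D.+1.
   Every polynomial is of this form for D large enough. *)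
Definition mpoly_eval {R : realType} (n D : nat)
  (a : {ffun 'I_n -> 'I_D.+1} -> R[i]) (t : 'I_n -> R) : R[i] :=
  \sum_(k : {ffun 'I_n -> 'I_D.+1})
     a k * \prod_(j < n) ((t j)%:C ^+ (nat_of_ord (k j))).

Definition multideg (n D : nat) (k : {ffun 'I_n -> 'I_D.+1}) : nat :=
  \sum_(j < n) nat_of_ord (k j).

Definition cRe {R : Type} (z : complex R) : R := let: Complex x _ := z in x.
Definition cIm {R : Type} (z : complex R) : R := let: Complex _ y := z in y.

(* Main.v *)
(** Necessity: near the origin the characteristic functions do not vanish, and
    [phi (- t)] is the conjugate of [phi t], so [exp (q (- t)) = exp (conj (q t))]
    there; as [q 0 = 0] this gives [q (- t) = conj (q t)], which is (ii).
    Restricting to a coordinate axis gives [exp q = 1] near the origin, hence (i).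

    Sufficiency: choose a positive density [f] on the line whose derivatives satisfy
    [|f^(k)| <= eps^k f]; such an [f] is necessarily band-limited, and is obtained by
    rescaling a sum of two translates of the Fejer kernel.  If [phi] is the Fourier
    transform of [f], that of [f^(k)] is [(- i t)^k phi t].  Writing [q] as a
    polynomial in the [- i t_j], which by (ii) has real coefficients, and replacing
    every monomial of [exp q] by the corresponding product of derivatives of [f],
    one obtains an integrable function with Fourier transform
    [phi t_1 ... phi t_n exp (q t)]; it is nonnegative since it differs from
    [f x_1 ... f x_n] by at most this product when [eps] is small.  By (i) its
    marginals have characteristic function [phi]. *)
Require Import Defs.
From HB Require Import structures.
From mathcomp Require Import all_boot all_order all_algebra.
From mathcomp Require Import all_classical all_reals all_analysis.
From mathcomp Require Import complex.
From mathcomp Require Import measurable_realfun ring lra.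
Set Implicit Arguments. Unset Strict Implicit. Unset Printing Implicit Defensive.
Import Order.TTheory GRing.Theory Num.Theory.
Import numFieldNormedType.Exports.
Local Open Scope classical_set_scope.
Local Open Scope ring_scope.
Local Open Scope complex_scope.

(** * Bounded functions, dominated convergence and constants under real-valued integrals *)

Section bounded_integrable.
Context {d : measure_display} {T : measurableType d} {R : realType}.

Lemma integrable_norm_le (mu : {measure set T -> \bar R}) (f g : T -> R) :
  mu.-integrable setT (EFin \o g) -> measurable_fun setT f ->
  (forall x, `|f x| <= g x) -> mu.-integrable setT (EFin \o f).
Proof.
move=> ig mf fg; apply: (le_integrable measurableT _ _ ig).
  exact/measurable_EFinP.
by move=> x _ /=; rewrite lee_fin (le_trans (fg x))// ler_norm.
Qed.

Lemma integrable_bounded (P : {finite_measure set T -> \bar R}) (g : T -> R) M :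
  measurable_fun setT g -> (forall x, `|g x| <= M) ->
  P.-integrable setT (EFin \o g).
Proof.
move=> mg gM; apply: (@integrable_norm_le _ _ (cst M)) => //.
exact: finite_measure_integrable_cst.
Qed.

Lemma Rintegral_cvg (mu : {measure set T -> \bar R}) (f_ : nat -> T -> R)
    (f g : T -> R) :
  (forall n, measurable_fun setT (f_ n)) -> measurable_fun setT f ->
  (forall x, f_ ^~ x @ \oo --> f x) -> mu.-integrable setT (EFin \o g) ->
  (forall n x, `|f_ n x| <= g x) ->
  Rintegral mu setT (f_ n) @[n --> \oo] --> Rintegral mu setT f.
Proof.
move=> mf_ mf f_f ig f_g.
have [i1 _ i2] : [/\ mu.-integrable setT (EFin \o f),
    [sequence \int[mu]_x `|(f_ n x)%:E - (f x)%:E|]_n @ \oo --> 0%E &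
    [sequence \int[mu]_x (f_ n x)%:E]_n @ \oo --> \int[mu]_x (f x)%:E]%E.
  apply: (@dominated_convergence _ _ _ mu setT measurableT (fun n => EFin \o f_ n)
    (EFin \o f) (EFin \o g)) => //.
  - by move=> n; exact/measurable_EFinP.
  - exact/measurable_EFinP.
  - by apply: aeW => x _; apply: cvg_EFin; [exact: nearW|exact: f_f].
  - by apply: aeW => x n _; rewrite lee_fin f_g.
apply: fine_cvg; rewrite fineK//.
exact: integrable_fin_num.
Qed.

Lemma Rintegral_probability_cst (P : probability T R) (r : R) :
  Rintegral P setT (fun=> r) = r.
Proof.
rewrite Rintegral_cst// -[RHS]mulr1; congr (_ * _).
exact: (congr1 fine (probability_setT P)).
Qed.

End bounded_integrable.

(** * Probability measures given by a density *)

Section density.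
Context {d : measure_display} {T : measurableType d} {R : realType}.
Variables (mu : {sigma_finite_measure set T -> \bar R}) (f : T -> R).
Hypothesis f_ge0 : forall x, 0 <= f x.
Hypothesis int_f : mu.-integrable setT (EFin \o f).
Hypothesis f1 : (\int[mu]_x (f x)%:E = 1)%E.

Definition with_density (A : set T) : \bar R := (\int[mu]_(x in A) (f x)%:E)%E.

Let dens0 : with_density set0 = 0%E.
Proof. by rewrite /with_density integral_set0. Qed.

Let dens_ge0 A : (0 <= with_density A)%E.
Proof. by apply: integral_ge0 => x _; rewrite lee_fin. Qed.

Let dens_sigma_additive : semi_sigma_additive with_density.
Proof.
move=> /= A mA tA mUA; rewrite /with_density integral_bigcup//=; last first.
  exact: integrableS int_f.
apply: is_cvg_ereal_nneg_natsum_cond => n _ _.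
by apply: integral_ge0 => x _; rewrite lee_fin.
Qed.

HB.instance Definition _ := isMeasure.Build _ _ _
  with_density dens0 dens_ge0 dens_sigma_additive.

Let dens_setT : with_density setT = 1%E.
Proof. exact: f1. Qed.

HB.instance Definition _ :=
  @Measure_isProbability.Build _ _ R with_density dens_setT.

Let dens_dom : with_density `<< mu.
Proof.
apply/null_content_dominatesP => A mA muA0; apply: null_set_integral => //.
apply: measurable_funTS; exact: measurable_int int_f.
Qed.

(** The measure with density [f] is dominated by [mu], and its Radon-Nikodym derivative agrees with
    [f] almost everywhere because both have the same integral over every measurable set; change of
    variables then gives the formula. Boundedness of [g] provides integrability under [P]. *)
Lemma exists_density : exists P : probability T R,
  forall (g : T -> R) (M : R), measurable_fun setT g ->
    (forall x, `|g x| <= M) ->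
    Rintegral P setT g = Rintegral mu setT (fun x => g x * f x).
Proof.
exists with_density => g M mg gM; congr fine.
have ig : (with_density : probability T R).-integrable setT (EFin \o g).
  exact: integrable_bounded mg gM.
rewrite -(Radon_Nikodym_change_of_variables dens_dom)//=.
apply: ae_eq_integral => //.
- apply: emeasurable_funM; first exact/measurable_EFinP.
  apply: (measurable_int mu); exact: Radon_Nikodym_integrable.
- apply/measurable_EFinP/measurable_funM => //.
  by apply/measurable_EFinP; exact: measurable_int int_f.
- under [X in ae_eq _ _ _ X]eq_fun do rewrite EFinM.
  apply: ae_eqe_mul2l => /=.
  rewrite Radon_NikodymE//=; case: cid => /= h [h1 h2 h3].
  apply: integral_ae_eq => //=.
  + exact: measurable_int int_f.
  + by move=> E _ mE; rewrite -h3.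
Qed.

End density.

(** * Characteristic functions with a real weight: linearity and products *)

Section weighted_charfun.
Context {R : realType}.

(* [E (H exp(i Y))] *)
Definition wcf {d} {T : measurableType d} (P : probability T R)
  (H Y : T -> R) : R[i] :=
  Complex (Rintegral P setT (fun w => H w * cos (Y w)))
          (Rintegral P setT (fun w => H w * sin (Y w))).

Lemma norm_cos_le1 (x : R) : `|cos x| <= 1.
Proof. by rewrite ler_norml cos_geN1 cos_le1. Qed.

Lemma norm_sin_le1 (x : R) : `|sin x| <= 1.
Proof. by rewrite ler_norml sin_geN1 sin_le1. Qed.

Lemma normM_le1 (x y M : R) : `|x| <= M -> `|y| <= 1 -> `|x * y| <= M.
Proof.
by move=> xM y1; rewrite normrM -[leRHS]mulr1 ler_pM.
Qed.

Lemma measurable_cosT {d} {T : measurableType d} (Y : T -> R) :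
  measurable_fun setT Y -> measurable_fun setT (fun w => cos (Y w)).
Proof.
by move=> mY; apply: measurableT_comp mY;
  apply: continuous_measurable_fun; exact: continuous_cos.
Qed.

Lemma measurable_sinT {d} {T : measurableType d} (Y : T -> R) :
  measurable_fun setT Y -> measurable_fun setT (fun w => sin (Y w)).
Proof.
by move=> mY; apply: measurableT_comp mY;
  apply: continuous_measurable_fun; exact: continuous_sin.
Qed.

Section linear.
Context {d : measure_display} {T : measurableType d} (P : probability T R).
Variables (Y : T -> R).
Hypothesis mY : measurable_fun setT Y.

Let int_cos (H : T -> R) M : measurable_fun setT H -> (forall w, `|H w| <= M) ->
  P.-integrable setT (EFin \o (fun w => H w * cos (Y w))).
Proof.
move=> mH HM; apply: (@integrable_bounded _ _ _ _ _ M).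
  by apply: measurable_funM => //; exact: measurable_cosT.
by move=> x; rewrite normM_le1// norm_cos_le1.
Qed.

Let int_sin (H : T -> R) M : measurable_fun setT H -> (forall w, `|H w| <= M) ->
  P.-integrable setT (EFin \o (fun w => H w * sin (Y w))).
Proof.
move=> mH HM; apply: (@integrable_bounded _ _ _ _ _ M).
  by apply: measurable_funM => //; exact: measurable_sinT.
by move=> x; rewrite normM_le1// norm_sin_le1.
Qed.

Lemma wcfD (H1 H2 : T -> R) M1 M2 :
  measurable_fun setT H1 -> (forall w, `|H1 w| <= M1) ->
  measurable_fun setT H2 -> (forall w, `|H2 w| <= M2) ->
  wcf P (fun w => H1 w + H2 w) Y = wcf P H1 Y + wcf P H2 Y.
Proof.
move=> m1 b1 m2 b2; rewrite /wcf; apply/eqP; rewrite eq_complex /=.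
apply/andP; split; apply/eqP.
- rewrite -RintegralD//; [|exact: int_cos b1|exact: int_cos b2].
  by apply: eq_Rintegral => w _; rewrite mulrDl.
- rewrite -RintegralD//; [|exact: int_sin b1|exact: int_sin b2].
  by apply: eq_Rintegral => w _; rewrite mulrDl.
Qed.

Lemma wcfZ (c : R) (H : T -> R) M :
  measurable_fun setT H -> (forall w, `|H w| <= M) ->
  wcf P (fun w => c * H w) Y = c%:C * wcf P H Y.
Proof.
move=> mH bH; rewrite /wcf; apply/eqP; rewrite eq_complex /=.
rewrite !mul0r subr0 addr0; apply/andP; split; apply/eqP.
- rewrite -RintegralZl//; last exact: int_cos bH.
  by apply: eq_Rintegral => w _; rewrite mulrA.
- rewrite -RintegralZl//; last exact: int_sin bH.
  by apply: eq_Rintegral => w _; rewrite mulrA.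
Qed.

Lemma wcf0 : wcf P (fun=> 0) Y = 0.
Proof.
rewrite /wcf; under eq_Rintegral do rewrite mul0r.
under [X in Complex _ X]eq_Rintegral do rewrite mul0r.
by rewrite /Rintegral integral0.
Qed.

End linear.

Section product.
Context {d1 d2 : measure_display} {T1 : measurableType d1}
  {T2 : measurableType d2}.
Variables (P1 : probability T1 R) (P2 : probability T2 R).

Lemma Rintegral_prod (f : T1 -> R) (g : T2 -> R) (M N : R) :
  measurable_fun setT f -> (forall w, `|f w| <= M) ->
  measurable_fun setT g -> (forall w, `|g w| <= N) ->
  Rintegral (P1 \x P2)%E setT (fun w => f w.1 * g w.2) =
  Rintegral P1 setT f * Rintegral P2 setT g.
Proof.
move=> mf fM mg gN.
have if_ := @integrable_bounded _ _ _ P1 _ _ mf fM.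
have ig := @integrable_bounded _ _ _ P2 _ _ mg gN.
have mfg : measurable_fun setT (fun w : T1 * T2 => f w.1 * g w.2).
  by apply: measurable_funM; exact: measurableT_comp.
have ifg : (P1 \x P2)%E.-integrable setT (fun w => (f w.1 * g w.2)%:E).
  apply: (@integrable_bounded _ _ _ ((P1 \x P2)%E : probability _ R) _ (M * N)) => //.
  by move=> w; rewrite normrM ler_pM.
rewrite /Rintegral -(integral12_prod_meas1 ifg) /fubini_F/=.
under eq_integral => x _.
  under eq_integral do rewrite EFinM.
  rewrite integralZl// -(fineK (integrable_fin_num _ ig))// -EFinM.
  rewrite mulrC EFinM; over.
rewrite integralZl// fineM ?integrable_fin_num//= mulrC//.
Qed.

(** The addition formulas for cosine and sine reproduce the real and imaginary parts of a complex
    product; Fubini factors each of the four resulting integrals. *)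
Lemma wcf_prod (H1 Y1 : T1 -> R) (H2 Y2 : T2 -> R) (M1 M2 : R) :
  measurable_fun setT H1 -> (forall w, `|H1 w| <= M1) ->
  measurable_fun setT H2 -> (forall w, `|H2 w| <= M2) ->
  measurable_fun setT Y1 -> measurable_fun setT Y2 ->
  wcf (P1 \x P2)%E (fun w => H1 w.1 * H2 w.2) (fun w => Y1 w.1 + Y2 w.2) =
  wcf P1 H1 Y1 * wcf P2 H2 Y2.
Proof.
move=> m1 b1 m2 b2 mY1 mY2.
have mc1 := measurable_funM m1 (measurable_cosT mY1).
have ms1 := measurable_funM m1 (measurable_sinT mY1).
have mc2 := measurable_funM m2 (measurable_cosT mY2).
have ms2 := measurable_funM m2 (measurable_sinT mY2).
have bc1 w := normM_le1 (b1 w) (norm_cos_le1 (Y1 w)).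
have bs1 w := normM_le1 (b1 w) (norm_sin_le1 (Y1 w)).
have bc2 w := normM_le1 (b2 w) (norm_cos_le1 (Y2 w)).
have bs2 w := normM_le1 (b2 w) (norm_sin_le1 (Y2 w)).
have iprod (f : T1 -> R) (g : T2 -> R) : measurable_fun setT f ->
    (forall w, `|f w| <= M1) -> measurable_fun setT g ->
    (forall w, `|g w| <= M2) ->
    (P1 \x P2)%E.-integrable setT (EFin \o (fun w => f w.1 * g w.2)).
  move=> mf bf mg bg.
  apply: (@integrable_bounded _ _ _ ((P1 \x P2)%E : probability _ R) _ (M1 * M2)).
    by apply: measurable_funM; exact: measurableT_comp.
  by move=> w; rewrite normrM ler_pM.
rewrite /wcf; apply/eqP; rewrite eq_complex /=; apply/andP; split; apply/eqP.
- rewrite -(Rintegral_prod mc1 bc1 mc2 bc2).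
  rewrite -(Rintegral_prod ms1 bs1 ms2 bs2).
  rewrite -RintegralB//; [|exact: iprod..].
  by apply: eq_Rintegral => w _ /=; rewrite cosD; ring.
- rewrite -(Rintegral_prod mc1 bc1 ms2 bs2).
  rewrite -(Rintegral_prod ms1 bs1 mc2 bc2).
  rewrite -RintegralD//; [|exact: iprod..].
  by apply: eq_Rintegral => w _ /=; rewrite sinD; ring.
Qed.

End product.
End weighted_charfun.

(** * Cosine transforms of polynomials on the unit interval *)

Section cosine_transform.
Context {R : realType}.
Local Notation mu := (@lebesgue_measure R).
Implicit Types (p : {poly R}) (c x t : R).

(** The phase [c] makes the family closed under differentiation in [x]: each derivative shifts it by
    a quarter turn and multiplies [p] by the variable. *)
Definition ctrig p c x : R :=
  Rintegral mu `[0, 1] (fun t => p.[t] * cos (t * x + c)).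

Lemma is_derive_affine (y c t : R) : is_derive t 1 (fun t => t * y + c) y.
Proof.
have -> : (fun t => t * y + c) = (y \*: id + cst c) :> (R -> R).
  by apply/funext => u /=; rewrite [in RHS]/GRing.add /= mulrC.
by apply: is_derive_eq; rewrite addr0 /GRing.scale/= mulr1.
Qed.

Lemma is_derive_cos_affine (y c t : R) :
  is_derive t 1 (fun t => cos (t * y + c)) (- sin (t * y + c) * y).
Proof.
exact: (@is_derive1_comp _ cos (fun t => t * y + c) t _ _ _
  (is_derive_affine y c t)).
Qed.

Lemma is_derive_sin_affine (y c t : R) :
  is_derive t 1 (fun t => sin (t * y + c)) (cos (t * y + c) * y).
Proof.
exact: (@is_derive1_comp _ sin (fun t => t * y + c) t _ _ _
  (is_derive_affine y c t)).
Qed.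

Lemma is_derive_continuous (f : R -> R) (x df : R) :
  is_derive x 1 f df -> {for x, continuous f}.
Proof.
by move=> [dfx _]; apply: differentiable_continuous; exact/derivable1_diffP.
Qed.

Lemma continuous_poly_cos p c x : continuous (fun t => p.[t] * cos (t * x + c)).
Proof.
move=> t; apply: (@continuousM _ _ (horner p)); first exact: continuous_horner.
exact: is_derive_continuous (is_derive_cos_affine _ _ _).
Qed.

Lemma integrable_segment (f : R -> R) (a b : R) : continuous f ->
  mu.-integrable `[a, b] (EFin \o f).
Proof.
move=> cf; apply: continuous_compact_integrable; first exact: segment_compact.
exact: continuous_subspaceT.
Qed.

Lemma Rintegral_FTC2 (f F : R -> R) (a b : R) : a < b -> continuous f ->
  (forall t, is_derive t 1 F (f t)) -> Rintegral mu `[a, b] f = F b - F a.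
Proof.
move=> ab cf dF.
have cF : continuous F by move=> t; exact: is_derive_continuous (dF t).
rewrite /Rintegral (@continuous_FTC2 _ f F)//.
- exact: continuous_subspaceT.
- split; first by move=> t _; have [] := dF t.
  + by apply: cvg_at_right_filter; exact: cF.
  + by apply: cvg_at_left_filter; exact: cF.
- by move=> t _; rewrite derive1E; have [] := dF t.
Qed.

Lemma ctrig_bound p c x (M : R) :
  (forall t, 0 <= t <= 1 -> `|p.[t]| <= M) -> `|ctrig p c x| <= M.
Proof.
move=> pM.
have ipc := @integrable_segment _ 0 1 (@continuous_poly_cos p c x).
rewrite /ctrig (le_trans (le_normr_Rintegral _ ipc))//.
have -> : M = Rintegral mu `[0, 1] (cst M).
  rewrite Rintegral_cst//.
  by rewrite /mu/= lebesgue_measure_itv//= lte01 oppr0 addr0 mulr1.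
apply: le_Rintegral => //.
- exact: integrable_norm.
- by apply: integrable_segment => t; exact: cvg_cst.
- by move=> t /=; rewrite in_itv/= => t01; rewrite normM_le1 ?pM// norm_cos_le1.
Qed.

Lemma is_derive_ctrig p c x :
  is_derive x 1 (ctrig p c) (ctrig ('X * p) (c + pi / 2) x).
Proof.
pose f (x t : R) : R := p.[t] * cos (t * x + c).
have df (u t : R) : is_derive u 1 (f ^~ t) (p.[t] * (- sin (u * t + c) * t)).
  have -> : f ^~ t = p.[t] \*: (fun u => cos (u * t + c)).
    by apply/funext => v; rewrite /f mulrC [t * v]mulrC mulrC.
  by have := is_derive_cos_affine t c u => h; exact: is_deriveZ.
have dfE (u t : R) : partial1of2 f u t = p.[t] * (- sin (u * t + c) * t).
  by rewrite partial1of2E; have [] := df u t.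
(* On the unit interval the [x]-derivative of the integrand is at most [|p|], since both [t] and the
   sine are bounded by 1; so a constant dominates it uniformly in [x]. *)
have [M pM] : exists M : R, forall t, 0 <= t <= 1 -> `|p.[t]| <= M.
  have [|u _ uM] := @EVT_max R (fun t => `|p.[t]|) 0 1 ler01.
    apply: continuous_subspaceT => t.
    by apply: continuous_comp; [exact: continuous_horner|exact: norm_continuous].
  by exists `|p.[u]| => t t01; apply: uM; rewrite in_itv.
have M0 : 0 <= M by rewrite (le_trans _ (pM 0 _))// lexx ler01.
have xI : `]x - 1, x + 1[%classic x by rewrite /= in_itv/= ltrBlDr ltrDl ltr01.
have hI u : `]x - 1, x + 1[%classic u -> mu.-integrable `[0, 1] (EFin \o f u).
  by move=> _; apply: integrable_segment; exact: continuous_poly_cos.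
have hD u t : `]x - 1, x + 1[%classic u -> `[0, 1]%classic t ->
    derivable (f ^~ t) u 1.
  by move=> _ _; have [] := df u t.
have hM u t : `]x - 1, x + 1[%classic u -> `[0, 1]%classic t ->
    `|partial1of2 f u t| <= cst M t.
  move=> _ /=; rewrite in_itv/= => t01; rewrite dfE normM_le1 ?pM//.
  rewrite normrM normrN -[leRHS]mulr1 ler_pM ?norm_sin_le1//.
  by case/andP: t01 => t0 t1; rewrite ger0_norm.
have iM : mu.-integrable `[0, 1] (EFin \o cst M).
  by apply: integrable_segment => t; exact: cvg_cst.
have -> : ctrig p c = (fun u => \int[mu]_(t in `[0, 1]) f u t) by [].
apply: DeriveDef.
  exact: (@derivable_under_integral R _ _ mu f _ (measurable_itv _) _ _ _ xI
    hI hD _ (fun=> M0) iM hM).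
rewrite -derive1E.
rewrite (@differentiation_under_integral R _ _ mu f _ (measurable_itv _) _ _ _ xI
  hI hD _ (fun=> M0) iM hM).
apply: eq_Rintegral => t _; rewrite dfE addrA cosDpihalf hornerM hornerX.
by rewrite [x * t]mulrC; ring.
Qed.

Lemma ctrig_parts p c x :
  x ^+ 2 * ctrig p c x =
  (p.[1] * x * sin (x + c) + p^`().[1] * cos (x + c)) -
  (p.[0] * x * sin c + p^`().[0] * cos c) - ctrig (p^`()^`()) c x.
Proof.
pose F t := p.[t] * x * sin (t * x + c) + p^`().[t] * cos (t * x + c).
have F1 : F 1 = p.[1] * x * sin (x + c) + p^`().[1] * cos (x + c).
  by rewrite /F mul1r.
have F0 : F 0 = p.[0] * x * sin c + p^`().[0] * cos c by rewrite /F mul0r add0r.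
rewrite -F1 -F0.
pose f t := (x ^+ 2 *: p + p^`()^`()).[t] * cos (t * x + c).
have dF t : is_derive t 1 F (f t).
  have dp (q : {poly R}) : is_derive t 1 (horner q) q^`().[t].
    exact: is_derive_poly.
  have ds := is_derive_sin_affine x c t.
  have dc := is_derive_cos_affine x c t.
  have -> : F = (horner (x *: p) * (fun t => sin (t * x + c)) +
                 horner p^`() * (fun t => cos (t * x + c))) :> (R -> R).
    by apply/funext => u; rewrite /F !fctE hornerZ; ring.
  apply: is_derive_eq.
  by rewrite /f !derivZ !hornerE /GRing.scale/=; ring.
have cf : continuous f by exact: continuous_poly_cos.
rewrite -(Rintegral_FTC2 ltr01 cf dF) /ctrig.
rewrite -RintegralZl//; last exact/integrable_segment/continuous_poly_cos.
rewrite -RintegralB//; [|exact: integrable_segment|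
  exact/integrable_segment/continuous_poly_cos].
by apply: eq_Rintegral => t _ /=; rewrite /f hornerD hornerZ; ring.
Qed.

End cosine_transform.

(** * A positive density whose derivatives are dominated by it *)

Section bandlimited_density.
Context {R : realType}.
Local Notation mu := (@lebesgue_measure R).
Implicit Types (x y s : R) (k : nat).

(* The k-th derivative of [x |-> (1 - cos x) / x^2], whose Fourier transform is
   supported on [-1, 1]. *)
Definition fejer_deriv k : R -> R :=
  ctrig ('X^k - 'X^(k.+1) : {poly R})%R (k%:R * (pi / 2)).
Local Notation g := fejer_deriv.

Lemma is_derive_fejer k x : is_derive x 1 (g k) (g k.+1 x).
Proof.
have -> : g k.+1 x = ctrig ('X * ('X^k - 'X^(k.+1)) : {poly R})%R
    (k%:R * (pi / 2) + pi / 2) x.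
  by rewrite /g mulrBr -!exprS -natr1 mulrDl mul1r.
exact: is_derive_ctrig.
Qed.

Lemma expr_in01 (t : R) k : 0 <= t <= 1 -> 0 <= t ^+ k <= 1.
Proof. by move=> /andP[t0 t1]; rewrite exprn_ge0//= exprn_ile1. Qed.

Lemma fejer_bound1 k x : `|g k x| <= 1.
Proof.
apply: ctrig_bound => t t01; rewrite !hornerE ler_norml.
have := expr_in01 k t01; have := expr_in01 k.+1 t01; lra.
Qed.

(** For [k = 0] the polynomial is [1 - X], whose second derivative is zero, so that only boundary
    terms survive the integration by parts. *)
Lemma fejer0_sqr x : x ^+ 2 * g 0 x = 1 - cos x.
Proof.
rewrite ctrig_parts mul0r addr0 sin0 cos0.
have -> : ('X^0 - 'X^1 : {poly R})^`() = (-1)%:P.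
  by rewrite expr0 expr1 derivB derivX (derivC 1) sub0r polyCN.
have -> : ctrig ((-1)%:P^`()) 0 x = 0.
  rewrite derivC /ctrig; under eq_Rintegral do rewrite horner0 mul0r.
  by rewrite /Rintegral integral0.
by rewrite !hornerC !hornerE; ring.
Qed.

(** Integration by parts would leave boundary terms growing like [x], but these vanish: at 1 the
    polynomial is zero, and at 0 either the polynomial or the sine of the phase is. The two other
    boundary terms cost [2 k + 1] each and the remaining integral [2 k^2], in total
    [2 (k + 1)^2]. *)
Lemma fejer_bound2 k x : x ^+ 2 * `|g k x| <= 2 * (k.+1%:R) ^+ 2.
Proof.
rewrite -[x ^+ 2]ger0_norm ?sqr_ge0// -normrM ctrig_parts.
have b0 : ('X^k - 'X^(k.+1) : {poly R}).[0] * x * sin (k%:R * (pi / 2)) = 0.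
  case: k => [|k]; first by rewrite mul0r sin0 mulr0.
  by rewrite !hornerE !expr0n/= subr0 !mul0r.
have b1 : ('X^k - 'X^(k.+1) : {poly R}).[1] = 0.
  by rewrite !hornerE !expr1n subrr.
have d1 t : 0 <= t <= 1 -> `|('X^k - 'X^(k.+1) : {poly R})^`().[t]| <= 2 * k%:R + 1.
  move=> t01; rewrite derivB !derivXn !(hornerD, hornerN, hornerMn, hornerXn) /=.
  have := expr_in01 k.-1 t01; have := expr_in01 k t01 => /andP[u0 u1] /andP[v0 v1].
  have k0 : 0 <= k%:R :> R by [].
  rewrite -mulr_natr -[X in _ - X]mulr_natr -natr1 ler_norml; nra.
have d2 t : 0 <= t <= 1 ->
    `|('X^k - 'X^(k.+1) : {poly R})^`()^`().[t]| <= 2 * k%:R ^+ 2.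
  move=> t01; rewrite derivB !derivXn derivB !derivMn !derivXn /=.
  rewrite !(hornerD, hornerN, hornerMn, hornerXn).
  have := expr_in01 k.-2 t01; have := expr_in01 k.-1 t01 => /andP[u0 u1] /andP[v0 v1].
  case: (posnP k) => [k0|k0].
    by rewrite k0 /= !mulr0n subrr normr0 mulr_ge0// sqr_ge0.
  have kE : k.-1%:R = k%:R - 1 :> R by rewrite -subn1 natrB.
  have k1 : 1 <= k%:R :> R by rewrite ler1n.
  rewrite -(mulr_natr (_ *+ k.-1)) -(mulr_natr (_ ^+ k.-2)).
  rewrite -(mulr_natr (_ *+ k)) -(mulr_natr (_ ^+ k.-1)) -natr1 kE.
  set K : R := k%:R in k1 *; set u := t ^+ k.-1 in u0 u1 *.
  set v := t ^+ k.-2 in v0 v1 *.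
  have K1 : 0 <= (K - 1) * K by nra.
  have K2 : 0 <= K * (K + 1) by nra.
  have h1 : 0 <= v * (K - 1) * K <= (K - 1) * K.
    by rewrite -mulrA mulr_ge0//= ler_piMl.
  have h2 : 0 <= u * K * (K + 1) <= K * (K + 1).
    by rewrite -mulrA mulr_ge0//= ler_piMl.
  have KK : K <= K * K by nra.
  rewrite ler_norml; lra.
rewrite b0 b1 !mul0r !add0r.
have i0 : 0 <= (0 : R) <= 1 by rewrite lexx ler01.
have i1 : 0 <= (1 : R) <= 1 by rewrite lexx ler01.
have h1 := normM_le1 (d1 _ i1) (norm_cos_le1 (x + k%:R * (pi / 2))).
have h0 := normM_le1 (d1 _ i0) (norm_cos_le1 (k%:R * (pi / 2))).
have h2 := ctrig_bound (k%:R * (pi / 2)) x d2.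
rewrite (le_trans (ler_normB _ _))// (le_trans (lerD (ler_normB _ _) h2))//.
rewrite (le_trans (lerD (lerD h1 h0) (lexx _)))//.
by rewrite -natr1 le_eqVlt; apply/orP; left; apply/eqP; ring.
Qed.

(** Adds the two previous bounds, using [k + 1 <= 2^k]. What matters is the geometric growth in [k],
    which a rescaling of the line can absorb. *)
Lemma fejer_decay k x : (1 + x ^+ 2) * `|g k x| <= 3 * 4 ^+ k.
Proof.
have := fejer_bound1 k x; have := fejer_bound2 k x => h1 h2.
have h3 : (k.+1%:R : R) ^+ 2 <= 4 ^+ k.
  rewrite (_ : 4 = 2 ^+ 2); last by rewrite expr2 -natrM.
  rewrite -exprM mulnC exprM lerXn2r ?nnegrE// -natrX ler_nat.
  by elim: k {h1 h2} => // k ih; rewrite expnS mul2n -addnn -addn1 leq_add// expn_gt0.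
have h4 : 1 <= 4 ^+ k :> R by rewrite exprn_ege1// ler1n.
rewrite mulrDl mul1r; lra.
Qed.

Lemma fejer0_ge0 x : 0 <= g 0 x.
Proof.
have [->|x0] := eqVneq x 0.
  rewrite /g /ctrig; apply: Rintegral_ge0 => t; rewrite /= in_itv/= => /andP[t0 t1].
  rewrite mulr0 mul0r addr0 cos0 mulr1 hornerD hornerN !hornerXn.
  by rewrite expr0 expr1 subr_ge0.
rewrite -(pmulr_rge0 (x := x ^+ 2)) ?exprn_even_gt0// fejer0_sqr subr_ge0.
exact: cos_le1.
Qed.

(* Adding a translate by pi removes the zeros of the Fejer kernel. *)
Definition bump_deriv k x : R := g k x + g k (x + pi).
Local Notation f := bump_deriv.

Lemma is_derive_bump k x : is_derive x 1 (f k) (f k.+1 x).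
Proof.
have h : is_derive x 1 (fun y => y + pi) 1.
  by have := is_derive_affine 1 pi x; under eq_fun do rewrite mulr1.
have h2 := @is_derive1_comp _ (g k) (fun y => y + pi) x _ _
   (is_derive_fejer k (x + pi)) h.
have h1 := is_derive_fejer k x.
have -> : f k = g k + (g k \o (fun y => y + pi)) by [].
by apply: is_derive_eq; rewrite mulr1.
Qed.

Lemma continuous_bump k : continuous (f k).
Proof. by move=> x; exact: is_derive_continuous (is_derive_bump k x). Qed.

Lemma pi_le4 : pi <= 4 :> R.
Proof. by have /andP[_] := @pihalf_02 R; lra. Qed.

(** The numerators [1 - cos x] and [1 - cos (x + pi) = 1 + cos x] add up to 2, while both [x^2] and
    [(x + pi)^2] are at most [2 x^2 + 32]; hence [1 <= f 0 x * (x^2 + 16)]. *)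
Lemma bump0_lower x : (16 * (1 + x ^+ 2))^-1 <= f 0 x.
Proof.
have e1 := fejer0_sqr x; have e2 := fejer0_sqr (x + pi).
rewrite cosDpi in e2.
have A := fejer0_ge0 x; have B := fejer0_ge0 (x + pi).
have p4 := pi_le4; have p0 := @pi_ge0 R.
have x2 : 0 <= x ^+ 2 by exact: sqr_ge0.
have q1 : x ^+ 2 <= 2 * x ^+ 2 + 32 by lra.
have q2 : (x + pi) ^+ 2 <= 2 * x ^+ 2 + 32.
  have := sqr_ge0 (x - pi); have : (pi : R) ^+ 2 <= 16 by nra.
  by move=> ? ?; nra.
have a1 := ler_wpM2r A q1; have a2 := ler_wpM2r B q2.
have fp : 1 <= f 0 x * (x ^+ 2 + 16) by rewrite /f; lra.
rewrite -[leLHS]mul1r ler_pdivrMr; last lra.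
rewrite (le_trans fp)// ler_wpM2l ?addr_ge0//; lra.
Qed.

Lemma bump0_gt0 x : 0 < f 0 x.
Proof.
by rewrite (lt_le_trans _ (bump0_lower x))// invr_gt0 mulr_gt0// ltr_wpDr// sqr_ge0.
Qed.

Lemma bump_decay k x : (1 + x ^+ 2) * `|f k x| <= 102 * 4 ^+ k.
Proof.
have h1 := fejer_decay k x; have h2 := fejer_decay k (x + pi).
have p4 := pi_le4; have p0 := @pi_ge0 R.
(* Comparing the weight at [x] with the one at [x + pi] costs a factor 33, whence the constant
   [3 + 33 * 3 = 102]. *)
have q : 1 + x ^+ 2 <= 33 * (1 + (x + pi) ^+ 2).
  have := sqr_ge0 (x + 2 * pi); have : (pi : R) ^+ 2 <= 16 by nra.
  have := sqr_ge0 (x + pi).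
  by move=> ? ? ?; nra.
have h3 := ler_wpM2r (normr_ge0 (g k (x + pi))) q.
have x0 : 0 <= 1 + x ^+ 2 by rewrite addr_ge0// sqr_ge0.
have h4 := ler_wpM2l x0 (ler_normD (g k x) (g k (x + pi))).
rewrite (le_trans h4)// mulrDr; lra.
Qed.

(** The upper bound for the derivatives and the lower bound for [f 0] have the same order
    [1 / (1 + x^2)], so their ratio is at most [102 * 16 * 4^(k+1)]. The exponent being positive,
    the constant can be moved inside the power. *)
Lemma bump_dominated : exists2 K : R, 0 < K &
  forall k x, `|f k.+1 x| <= K ^+ k.+1 * f 0 x.
Proof.
pose c : R := 102 * 16.
have c1 : 1 <= c by rewrite /c; lra.
exists (c * 4); first by rewrite mulr_gt0// (lt_le_trans ltr01).
move=> k x.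
have x0 : 0 < 1 + x ^+ 2 by rewrite ltr_wpDr// sqr_ge0.
have f1 : 1 <= f 0 x * (16 * (1 + x ^+ 2)).
  by rewrite -ler_pdivrMr ?mul1r ?bump0_lower// mulr_gt0.
have e : 0 <= 102 * 4 ^+ k.+1 :> R by rewrite mulr_ge0// exprn_ge0.
apply: (@le_trans _ _ (c * 4 ^+ k.+1 * f 0 x)).
  rewrite -(ler_pM2l x0) (le_trans (bump_decay k.+1 x))//.
  rewrite -[leLHS]mulr1 (le_trans (ler_wpM2l e f1))//.
  by rewrite le_eqVlt; apply/orP; left; apply/eqP; rewrite /c; ring.
rewrite exprMn; apply: ler_wpM2r; first by rewrite ltW// bump0_gt0.
apply: ler_wpM2r; first by rewrite exprn_ge0.
by rewrite exprS ler_peMr ?exprn_ege1// (le_trans ler01).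
Qed.

Lemma integral_oneDsqrV : (\int[mu]_x ((1 + x ^+ 2)^-1)%:E = pi%:E)%E.
Proof.
have f0 (x : R) : 0 <= (1 + x ^+ 2)^-1 by rewrite invr_ge0 addr_ge0// sqr_ge0.
rewrite (@ge0_symfun_integralT R (fun x : R => (1 + x ^+ 2)^-1))//=.
- have := @integral0y_oneDsqr R; rewrite set_itvcy /oneDsqr => ->.
  by rewrite -EFinM mulrC divfK.
- exact: continuous_oneDsqrV.
- by move=> x /=; rewrite sqrrN.
Qed.

Lemma integrable_oneDsqrV : mu.-integrable setT (EFin \o (fun x => (1 + x ^+ 2)^-1)).
Proof.
have mf : measurable_fun setT (fun x : R => (1 + x ^+ 2)^-1).
  by apply: continuous_measurable_fun; exact: continuous_oneDsqrV.
apply/integrableP; split; first exact/measurable_EFinP.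
have f0 (x : R) : 0 <= (1 + x ^+ 2)^-1 by rewrite invr_ge0 addr_ge0// sqr_ge0.
under eq_integral do rewrite /= ger0_norm//.
by rewrite integral_oneDsqrV ltry.
Qed.

Lemma integrable_bump_mul k (h : R -> R) :
  measurable_fun setT h -> (forall x, `|h x| <= 1) ->
  mu.-integrable setT (EFin \o (fun x => f k x * h x)).
Proof.
move=> mh h1.
have ig := integrableZl measurableT (102 * 4 ^+ k) integrable_oneDsqrV.
apply: (@integrable_norm_le _ _ R mu _
  (fun x : R => (102 * 4 ^+ k) * (1 + x ^+ 2)^-1)) => //.
  by apply: measurable_funM => //; apply: continuous_measurable_fun;
    exact: continuous_bump.
move=> x; apply: normM_le1 => //.
have x0 : 0 < 1 + x ^+ 2 by rewrite ltr_wpDr// sqr_ge0.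
by rewrite ler_pdivlMr// mulrC bump_decay.
Qed.

Lemma integrable_bump k : mu.-integrable setT (EFin \o f k).
Proof.
have -> : f k = (fun x => f k x * 1) by apply/funext => x; rewrite mulr1.
by apply: integrable_bump_mul => // x; rewrite normr1.
Qed.

(** The integral over [[-a, a]] is [F a - F (- a)], which tends to 0 by the decay of [F]; dominated
    convergence passes to the whole line. *)
Lemma Rintegral_derive_eq0 (F F' : R -> R) (C : R) : continuous F' ->
  (forall x, is_derive x 1 F (F' x)) -> mu.-integrable setT (EFin \o F') ->
  (forall x, (1 + x ^+ 2) * `|F x| <= C) -> Rintegral mu setT F' = 0.
Proof.
move=> cF' dF iF' FC.
pose a (n : nat) : R := n.+1%:R.
pose u (n : nat) := F' \_ `[- a n, a n].
have mF' : measurable_fun setT F' by exact: continuous_measurable_fun.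
have cu : Rintegral mu setT (u n) @[n --> \oo] --> Rintegral mu setT F'.
  apply: (@Rintegral_cvg _ _ R mu u F' (fun x : R => `|F' x|)) => //.
  - by move=> n; apply/measurable_restrict => //; rewrite setTI;
      exact: measurable_funTS.
  - move=> x; apply: cvg_near_cst.
    have [m xm] : exists m : nat, `|x| <= m%:R.
      by exists (Num.truncn `|x|).+1; rewrite ltW// truncnS_gt.
    exists m => // n /= mn; rewrite /u patchE mem_set//= in_itv/= -ler_norml.
    by rewrite (le_trans xm)// ler_nat (leq_trans mn).
  - exact: integrable_norm.
  - by move=> n x; rewrite /u patchE; case: ifP => // _; rewrite normr0.
have uE n : Rintegral mu setT (u n) = F (a n) - F (- a n).
  rewrite -Rintegral_mkcond (Rintegral_FTC2 (F := F))//.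
  by rewrite -subr_gt0 opprK addr_gt0.
have cF (e : nat -> R) : (forall n, `|e n| = a n) -> F (e n) @[n --> \oo] --> 0.
  move=> ea; apply: norm_cvg0.
  have c0 : C * (a n)^-1 @[n --> \oo] --> 0.
    by rewrite -(mulr0 C); apply: cvgMr; exact: cvg_harmonic.
  apply: (@squeeze_cvgr _ _ _ _ (cst 0) _ _ _ _ _ c0); last exact: cvg_cst.
  apply: nearW => n; rewrite normr_ge0/= ler_pdivlMr//.
  rewrite (le_trans _ (FC (e n)))// mulrC ler_wpM2r//.
  rewrite -[e n ^+ 2]real_normK ?num_real// ea ler_wpDl// expr2 ler_peMl//.
  by rewrite ler1n.
have c0 : Rintegral mu setT (u n) @[n --> \oo] --> 0.
  under eq_fun do rewrite uE.
  rewrite -(subrr 0); apply: cvgB; apply: cF => n; rewrite ?normrN ger0_norm//.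
by rewrite -(cvg_lim _ cu)// (cvg_lim _ c0).
Qed.

Lemma Rintegral_bump0_gt0 : 0 < Rintegral mu setT (f 0).
Proof.
have i1 := integrableZl measurableT (16^-1) integrable_oneDsqrV.
apply: (@lt_le_trans _ _ (Rintegral mu setT (fun x => 16^-1 * (1 + x ^+ 2)^-1))).
  rewrite RintegralZl//; last exact: integrable_oneDsqrV.
  by rewrite /Rintegral integral_oneDsqrV mulr_gt0 ?invr_gt0 ?pi_gt0.
apply: le_Rintegral => //; first exact: integrable_bump.
by move=> x _; rewrite -invfM bump0_lower.
Qed.

Definition bump_fourier k s : R[i] :=
  Complex (Rintegral mu setT (fun x => f k x * cos (s * x)))
          (Rintegral mu setT (fun x => f k x * sin (s * x))).

(** Integration by parts on the line: the derivatives of [f k x * cos (s x)] and [f k x * sin (s x)]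
    have zero integral, which gives the real and the imaginary part. *)
Lemma bump_fourierS k s :
  bump_fourier k.+1 s = (- 'i%C * s%:C) * bump_fourier k s.
Proof.
have mc : measurable_fun setT (fun x : R => cos (s * x)).
  by apply: measurable_cosT; exact: measurable_funM.
have ms : measurable_fun setT (fun x : R => sin (s * x)).
  by apply: measurable_sinT; exact: measurable_funM.
have ic j := @integrable_bump_mul j _ mc (fun x => norm_cos_le1 (s * x)).
have is_ j := @integrable_bump_mul j _ ms (fun x => norm_sin_le1 (s * x)).
have dc x : is_derive x 1 (fun x => cos (s * x)) (- sin (s * x) * s).
  have := is_derive_cos_affine s 0 x.
  by under eq_fun do rewrite addr0 mulrC; rewrite addr0 [x * s]mulrC.
have ds x : is_derive x 1 (fun x => sin (s * x)) (cos (s * x) * s).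
  have := is_derive_sin_affine s 0 x.
  by under eq_fun do rewrite addr0 mulrC; rewrite addr0 [x * s]mulrC.
have cc : continuous (fun x => cos (s * x)).
  by move=> x; exact: is_derive_continuous (dc x).
have cs : continuous (fun x => sin (s * x)).
  by move=> x; exact: is_derive_continuous (ds x).
have decay (h : R -> R) : (forall x, `|h x| <= 1) ->
    forall x, (1 + x ^+ 2) * `|f k x * h x| <= 102 * 4 ^+ k.
  move=> h1 x; rewrite (le_trans _ (bump_decay k x))// ler_wpM2l//.
    by rewrite addr_ge0// sqr_ge0.
  exact: normM_le1.
have zc : Rintegral mu setT (fun x => f k.+1 x * cos (s * x) -
    s * (f k x * sin (s * x))) = 0.
  apply: (@Rintegral_derive_eq0 (fun x => f k x * cos (s * x)) _ (102 * 4 ^+ k)).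
  - move=> x; apply: cvgB; first by apply: cvgM; [exact: continuous_bump|exact: cc].
    by apply: cvgMr; apply: cvgM; [exact: continuous_bump|exact: cs].
  - move=> x; have d1 := is_derive_bump k x; have d2 := dc x.
    have := is_deriveM d1 d2; move=> d3; apply: (is_derive_eq d3).
    by rewrite /GRing.scale/=; ring.
  - by have := integrableB measurableT (ic k.+1) (integrableZl measurableT s (is_ k)).
  - by apply: decay => x; exact: norm_cos_le1.
have zs : Rintegral mu setT (fun x => f k.+1 x * sin (s * x) +
    s * (f k x * cos (s * x))) = 0.
  apply: (@Rintegral_derive_eq0 (fun x => f k x * sin (s * x)) _ (102 * 4 ^+ k)).
  - move=> x; apply: cvgD; first by apply: cvgM; [exact: continuous_bump|exact: cs].
    by apply: cvgMr; apply: cvgM; [exact: continuous_bump|exact: cc].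
  - move=> x; have d1 := is_derive_bump k x; have d2 := ds x.
    have := is_deriveM d1 d2; move=> d3; apply: (is_derive_eq d3).
    by rewrite /GRing.scale/=; ring.
  - by have := integrableD measurableT (is_ k.+1) (integrableZl measurableT s (ic k)).
  - by apply: decay => x; exact: norm_sin_le1.
move: zc zs.
have isZ : mu.-integrable setT (EFin \o (fun x => s * (f k x * sin (s * x)))).
  exact: (integrableZl measurableT s (is_ k)).
have icZ : mu.-integrable setT (EFin \o (fun x => s * (f k x * cos (s * x)))).
  exact: (integrableZl measurableT s (ic k)).
rewrite (RintegralB measurableT (ic k.+1) isZ).
rewrite (RintegralD measurableT (is_ k.+1) icZ).
rewrite (RintegralZl s measurableT (ic k)) (RintegralZl s measurableT (is_ k)).
move=> /eqP; rewrite subr_eq0 => /eqP hc /eqP; rewrite addr_eq0 => /eqP hs.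
by rewrite /bump_fourier hc hs; simpc; congr Complex; ring.
Qed.

Lemma bump_fourierE k s : bump_fourier k s = (- 'i%C * s%:C) ^+ k * bump_fourier 0 s.
Proof.
elim: k => [|k ih]; first by rewrite mul1r.
by rewrite bump_fourierS ih exprS mulrA.
Qed.

(** Probabilistic form of the density with small derivatives: [r k] is the ratio of the [k]-th
    derivative of the density of [X] to that density. Weighting by it differentiates the density,
    hence multiplies the characteristic function by [(- i s)^k]. *)
Lemma exists_bandlimited (eps : R) : 0 < eps ->
  exists (d : measure_display) (T : measurableType d) (P : probability T R)
    (X : T -> R) (r : nat -> T -> R),
  [/\ measurable_fun setT X, (forall k, measurable_fun setT (r k)),
      (forall k w, `|r k w| <= eps ^+ k), (forall w, r 0 w = 1) &
      forall k s, wcf P (r k) (fun w => s * X w) =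
        (- 'i%C * s%:C) ^+ k * wcf P (fun=> 1) (fun w => s * X w)].
Proof.
move=> eps0; pose Z := Rintegral mu setT (f 0).
have Z0 : 0 < Z by exact: Rintegral_bump0_gt0.
have [K K0 bK] := bump_dominated.
(* Stretching the line by [lam] divides the [k]-th derivative by [lam^k], relative to the density,
   and so turns the bound [K^k] into [eps^k]. *)
pose lam : R := K / eps.
have lam0 : 0 < lam by rewrite divr_gt0.
have iZ : mu.-integrable setT (EFin \o (fun x => Z^-1 * f 0 x)).
  exact: (integrableZl measurableT Z^-1 (integrable_bump 0)).
have dens_ge0 x : 0 <= Z^-1 * f 0 x by rewrite mulr_ge0 ?invr_ge0 ?ltW ?bump0_gt0.
have dens1 : (\int[mu]_x (Z^-1 * f 0 x)%:E = 1)%E.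
  have := @RintegralZl _ _ _ mu setT (f 0) Z^-1 measurableT (integrable_bump 0).
  rewrite -/Z mulVf ?gt_eqF// /Rintegral => h.
  by rewrite -[LHS]fineK ?h//; exact: integrable_fin_num.
have [P PE] := @exists_density _ _ R mu _ dens_ge0 iZ dens1.
pose X (x : R) := lam * x.
pose r (k : nat) (x : R) := lam ^- k * (f k x / f 0 x).
have mf k : measurable_fun setT (f k).
  by apply: continuous_measurable_fun; exact: continuous_bump.
have mX : measurable_fun setT X by exact: measurable_funM.
have mr k : measurable_fun setT (r k).
  apply: measurable_funM => //; apply: measurable_funM => //.
  apply: continuous_measurable_fun => x; apply: cvgV.
    by rewrite gt_eqF// bump0_gt0.
  exact: continuous_bump.
have r0 w : r 0 w = 1 by rewrite /r expr0 invr1 mul1r divff// gt_eqF// bump0_gt0.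
have br k w : `|r k w| <= eps ^+ k.
  case: k => [|k]; first by rewrite r0 normr1.
  rewrite /r normrM normfV (ger0_norm (exprn_ge0 _ (ltW lam0))).
  rewrite mulrC ler_pdivrMr ?exprn_gt0// -exprMn (_ : eps * lam = K); last first.
    by rewrite /lam mulrC divfK ?gt_eqF.
  rewrite normrM normfV (ger0_norm (ltW (bump0_gt0 w))) ler_pdivrMr ?bump0_gt0//.
exists _, _, P, X, r; split => //.
(* Against the density [f 0 / Z] the denominator of [r k] cancels, and a plain Fourier integral of
   [f k] at the rescaled frequency remains. *)
have key k s : wcf P (r k) (fun w => s * X w) =
    (Z^-1 * lam ^- k)%:C * bump_fourier k (s * lam).
  have mY : measurable_fun setT (fun w => s * X w) by exact: measurable_funM.
  have mc := measurable_funM (mr k) (measurable_cosT mY).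
  have ms := measurable_funM (mr k) (measurable_sinT mY).
  rewrite /wcf (PE _ (eps ^+ k) mc); last first.
    by move=> x; rewrite normM_le1// norm_cos_le1.
  rewrite (PE _ (eps ^+ k) ms); last first.
    by move=> x; rewrite normM_le1// norm_sin_le1.
  have fE x (u : R) : r k x * u * (Z^-1 * f 0 x) = (Z^-1 * lam ^- k) * (f k x * u).
    have fx : f 0 x != 0 by rewrite gt_eqF// bump0_gt0.
    have zx : Z != 0 by rewrite gt_eqF.
    have lx : lam ^+ k != 0 by rewrite expf_neq0// gt_eqF.
    by rewrite /r; field; rewrite fx zx lx.
  rewrite /bump_fourier; simpc; congr Complex.
  - rewrite -RintegralZl//; first by apply: eq_Rintegral => x _; rewrite fE /X mulrA.
    apply: integrable_bump_mul; last by move=> x; exact: norm_cos_le1.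
    by apply: measurable_cosT; exact: measurable_funM.
  - rewrite -RintegralZl//; first by apply: eq_Rintegral => x _; rewrite fE /X mulrA.
    apply: integrable_bump_mul; last by move=> x; exact: norm_sin_le1.
    by apply: measurable_sinT; exact: measurable_funM.
move=> k s.
have -> : wcf P (fun=> 1) (fun w => s * X w) = wcf P (r 0) (fun w => s * X w).
  by congr wcf; apply/funext => w; rewrite r0.
have lk : lam%:C ^+ k != 0 by rewrite expf_neq0// (inj_eq (@complexI _)) gt_eqF.
have e : (lam ^- k)%:C * (- 'i%C * (s * lam)%:C) ^+ k = (- 'i%C * s%:C) ^+ k.
  have -> : - 'i%C * (s * lam)%:C = (- 'i%C * s%:C) * lam%:C.
    by rewrite rmorphM mulrA.
  by rewrite (exprMn _ (- 'i%C * s%:C)) mulrCA fmorphV rmorphXn mulVf ?mulr1.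
rewrite !key bump_fourierE expr0 invr1 mulr1 [(Z^-1 * _)%:C]rmorphM -e.
by rewrite !mulrA; congr (_ * _); rewrite [RHS]mulrC mulrA.
Qed.

End bandlimited_density.

(** * Partial sums of the exponential series and their products *)

Section exp_partial_sums.

(** Stated over any numeric field so that real and complex partial sums can be compared. *)
Definition texp {F : numFieldType} (x : F) (N : nat) : F :=
  \sum_(m < N) x ^+ m / m`!%:R.

Context {F : numFieldType}.
Implicit Types x y : F.

Lemma texpD x y N : texp (x + y) N =
  \sum_(i < N) \sum_(j < N | (i + j < N)%N) (x ^+ i / i`!%:R) * (y ^+ j / j`!%:R).
Proof.
pose a i j := (x ^+ i / i`!%:R) * (y ^+ j / j`!%:R).
have expand (m : 'I_N) : (x + y) ^+ m / m`!%:R =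
    \sum_(i < N | (i < m.+1)%N) a i (m - i)%N.
  rewrite -(big_ord_widen _ (fun i => a i (m - i)%N)) ?ltn_ord//.
  rewrite addrC exprDn mulr_suml; apply: eq_bigr => i _.
  have im : (i <= m)%N by rewrite -ltnS.
  have h : m`!%:R = ('C(m, i) * i`! * (m - i)`!)%:R :> F.
    by rewrite -mulnA bin_fact.
  have f0 k : k`!%:R != 0 :> F by rewrite pnatr_eq0 -lt0n fact_gt0.
  have b0 : 'C(m, i)%:R != 0 :> F by rewrite pnatr_eq0 -lt0n bin_gt0.
  rewrite h !natrM /a -mulr_natr; field.
  by rewrite b0 !f0.
rewrite /texp (eq_bigr _ (fun m _ => expand m)).
rewrite (exchange_big_dep predT)//=; apply: eq_bigr => i _.
rewrite (eq_bigl (fun m : 'I_N => (i <= m)%N)) => [|m]; last by rewrite ltnS.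
transitivity (\sum_(i <= m < N) a i (m - i)%N).
  by rewrite big_geq_mkord.
rewrite -{1}(add0n i) big_addn big_mkord.
rewrite (eq_bigr (fun j : 'I_(N - i) => a i j)) => [|j _]; last by rewrite addnK.
rewrite (big_ord_widen N (a i)) ?leq_subr//.
by apply: eq_bigl => j; rewrite ltn_subRL.
Qed.

Lemma texp_mul_sub x y N : texp x N * texp y N - texp (x + y) N =
  \sum_(i < N) \sum_(j < N | ~~ (i + j < N)%N)
    (x ^+ i / i`!%:R) * (y ^+ j / j`!%:R).
Proof.
rewrite texpD {1}/texp mulr_suml -sumrB; apply: eq_bigr => i _.
rewrite /texp mulr_sumr (bigID (fun j : 'I_N => (i + j < N)%N))/=.
by rewrite addrAC subrr add0r.
Qed.

(** The difference consists of the products of terms with [i + j >= N]; the triangle inequality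
    bounds it by the same expression at the absolute values. This reduces the complex functional
    equation to the real one. *)
Lemma texp_mul_sub_norm x y N : `|texp x N * texp y N - texp (x + y) N| <=
  texp `|x| N * texp `|y| N - texp (`|x| + `|y|) N.
Proof.
rewrite !texp_mul_sub (le_trans (ler_norm_sum _ _ _))// ler_sum// => i _.
rewrite (le_trans (ler_norm_sum _ _ _))// ler_sum// => j _.
by rewrite !normrM !normfV !normrX !normr_nat.
Qed.

End exp_partial_sums.

(** * The exponential series converges to [cexp] *)

Section complex_exponential.
Context {R : realType}.
Implicit Types (a b : R) (z : R[i]).

Lemma texp_series a N : texp a N = series (exp_coeff a) N.
Proof. by rewrite /series/= big_mkord. Qed.

Lemma texp_real_complex a N : texp a%:C N = (texp a N)%:C.
Proof.
rewrite /texp rmorph_sum; apply: eq_bigr => m _.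
by rewrite rmorphM fmorphV rmorphXn rmorph_nat.
Qed.

Lemma texp_imaginary b N : texp ('i%C * b%:C) N =
  Complex (series (cos_coeff b) N) (series (sin_coeff b) N).
Proof.
have term m : ('i%C * b%:C) ^+ m / m`!%:R = Complex (cos_coeff b m) (sin_coeff b m).
  have -> : (m`!%:R)^-1 = ((m`!%:R)^-1)%:C :> R[i] by rewrite fmorphV rmorph_nat.
  rewrite exprMn -rmorphXn -mulrA -rmorphM.
  (* The powers of i split by parity, in the shape of the cosine and sine coefficients. *)
  have -> : 'i%C ^+ m = Complex ((~~ odd m)%:R * (-1) ^+ m./2)
      ((odd m)%:R * (-1) ^+ m./2) :> R[i].
    rewrite -{1}(odd_double_half m) exprD -mul2n exprM sqr_i.
    have -> : (-1) ^+ m./2 = ((-1) ^+ m./2)%:C :> R[i] by rewrite rmorphXn rmorphN1.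
    by case: (odd m); rewrite ?expr1 ?expr0 ?mul1r; simpc; rewrite ?mul1r ?mul0r.
  rewrite /cos_coeff /sin_coeff/=; simpc; congr Complex.
    by rewrite -exprnP !mulrA.
  case: m => [|m]; first by rewrite !mul0r.
  by rewrite /= uphalf_half; case: (odd m); rewrite ?mul0r// !mulrA.
rewrite /texp (eq_bigr _ (fun (m : 'I_N) _ => term m)) /series/= !big_mkord.
elim/big_rec3: _ => [|i u v w _ ->]; by rewrite //; simpc.
Qed.

Lemma expR_texp_cvg a : texp a N @[N --> \oo] --> expR a.
Proof.
rewrite (_ : (fun N => texp a N) = series (exp_coeff a)).
  exact: is_cvg_series_exp_coeff.
by apply/funext => N; rewrite texp_series.
Qed.

Lemma normc_ge_Im z : `|complex.Im z|%:C <= `|z|.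
Proof.
have := normc_ge_Re (z * 'i%C).
by rewrite ReiNIm normrN normrM (_ : `|'i%C| = 1) ?mulr1// normc_def/=
  expr0n expr1n add0r sqrtr1.
Qed.

(** For [z = a + i b], the product of the partial sums at [a] and at [i b] converges by the real
    series of exp, cos and sin. It differs from the partial sum at [z] by at most [e N], which tends
    to 0 because [expR] turns sums into products. *)
Lemma cexp_texp_cvg z :
  (complex.Re (texp z N) @[N --> \oo] --> complex.Re (cexp z)) /\
  (complex.Im (texp z N) @[N --> \oo] --> complex.Im (cexp z)).
Proof.
case: z => a b.
pose e N := texp `|a| N * texp `|b| N - texp (`|a| + `|b|) N.
have e0 : e N @[N --> \oo] --> 0.
  rewrite -(subrr (expR (`|a| + `|b|))) {1}expRD.
  by apply: cvgB; [apply: cvgM|]; exact: expR_texp_cvg.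
pose w N := texp a%:C N * texp ('i%C * b%:C) N.
have we N : `|w N - texp (Complex a b) N| <= (e N)%:C.
  rewrite (_ : Complex a b = a%:C + 'i%C * b%:C); last by simpc.
  rewrite (le_trans (texp_mul_sub_norm _ _ _))// normrM.
  have -> : `|'i%C : R[i]| = 1 by rewrite normc_def/= expr0n expr1n add0r sqrtr1.
  have nr (u : R) : `|u%:C| = `|u|%:C by rewrite normc_def/= expr0n addr0 sqrtr_sqr.
  by rewrite mul1r !nr -rmorphD !texp_real_complex -rmorphM -rmorphB.
have wE N : w N = Complex (texp a N * series (cos_coeff b) N)
                          (texp a N * series (sin_coeff b) N).
  by rewrite /w texp_real_complex texp_imaginary; simpc.
have ccos : series (cos_coeff b) N @[N --> \oo] --> cos b.
  by rewrite cos.unlock; exact: is_cvg_series_cos_coeff.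
have csin : series (sin_coeff b) N @[N --> \oo] --> sin b.
  by rewrite sin.unlock; exact: is_cvg_series_sin_coeff.
have squeeze (u v : nat -> R) (l : R) : u N @[N --> \oo] --> l ->
    (forall N, `|u N - v N| <= e N) -> v N @[N --> \oo] --> l.
  move=> ul uve; rewrite -[l]subr0.
  have -> : v = (fun N => u N - (u N - v N)).
    by apply/funext => N; rewrite opprB addrC subrK.
  apply: cvgB ul _; apply: norm_cvg0.
  apply: (@squeeze_cvgr _ _ _ _ (cst 0) _ _ _ _ _ e0); last exact: cvg_cst.
  by apply: nearW => N; rewrite normr_ge0 uve.
split.
- apply: (squeeze (fun N => complex.Re (w N))).
    under eq_fun do rewrite wE /=.
    by apply: cvgM => //; exact: expR_texp_cvg.
  by move=> N; rewrite -lecR -raddfB (le_trans (normc_ge_Re _)).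
- apply: (squeeze (fun N => complex.Im (w N))).
    under eq_fun do rewrite wE /=.
    by apply: cvgM => //; exact: expR_texp_cvg.
  by move=> N; rewrite -lecR -raddfB (le_trans (normc_ge_Im _)).
Qed.

End complex_exponential.

(** * Independent copies on a product space *)

Section iid.
Context {R : realType} {d0 : measure_display} {T0 : measurableType d0}.

Lemma norm_prod_le (I : finType) (F M : I -> R) :
  (forall j, `|F j| <= M j) -> `|\prod_j F j| <= \prod_j M j.
Proof. by move=> FM; rewrite normr_prod; apply: ler_prod => j _; rewrite FM andbT. Qed.

(** Independence is recorded directly as factorisation of weighted characteristic functions. By
    induction on [n], adding one factor [P0] to the product space at each step. *)
Lemma exists_iid (P0 : probability T0 R) (n : nat) :
  exists (d : measure_display) (T : measurableType d) (P : probability T R)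
    (pr : 'I_n -> T -> T0), (forall j, measurable_fun setT (pr j)) /\
  forall (H Y : 'I_n -> T0 -> R) (M : 'I_n -> R),
    (forall j, measurable_fun setT (H j)) -> (forall j w, `|H j w| <= M j) ->
    (forall j, measurable_fun setT (Y j)) ->
    wcf P (fun w => \prod_j H j (pr j w)) (fun w => \sum_j Y j (pr j w)) =
    \prod_j wcf P0 (H j) (Y j).
Proof.
elim: n => [|n [d [T [P [pr [mpr IH]]]]]].
  (* With no coordinates any probability space serves; [P0] itself is taken. *)
  exists d0, T0, P0, (fun=> id); split=> // H Y M _ _ _; rewrite big_ord0 /wcf.
  under eq_Rintegral do rewrite !big_ord0 cos0 mulr1.
  under [X in Complex _ X]eq_Rintegral do rewrite !big_ord0 sin0 mulr0.
  by rewrite !Rintegral_probability_cst.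
pose pr' (j : 'I_n.+1) (w : T0 * T) :=
  if unlift ord0 j is Some i then pr i w.2 else w.1.
exists _, (T0 * T)%type, (P0 \x P)%E, pr'; split.
  move=> j; rewrite /pr'; case: (unlift ord0 j) => [i|]; last exact: measurable_fst.
  by apply: measurableT_comp; [exact: mpr|exact: measurable_snd].
move=> H Y M mH HM mY.
rewrite big_ord_recl -(IH _ _ _ (fun i => mH (lift ord0 i))
  (fun i => HM (lift ord0 i)) (fun i => mY (lift ord0 i))).
have mH2 : measurable_fun setT (fun w => \prod_i H (lift ord0 i) (pr i w)).
  apply: measurable_prod => i _.
  by apply: measurableT_comp; [exact: mH|exact: mpr].
have bH2 w : `|\prod_i H (lift ord0 i) (pr i w)| <= \prod_i M (lift ord0 i).
  by apply: norm_prod_le => i; exact: HM.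
have mY2 : measurable_fun setT (fun w => \sum_i Y (lift ord0 i) (pr i w)).
  apply: measurable_sum => i.
  by apply: measurableT_comp; [exact: mY|exact: mpr].
rewrite -(wcf_prod P0 P (mH ord0) (HM ord0) mH2 bH2 (mY ord0) mY2).
by congr wcf; apply/funext => w; rewrite big_ord_recl /pr' unlift_none;
  congr (_ _ _); apply: eq_bigr => i _; rewrite liftK.
Qed.

End iid.

(* A polynomial is given by the list of its terms (coefficient, exponents);
   repeated exponents are allowed, so products need no normalisation. *)
Section term_lists.
Context {R : realType} {n : nat}.
Local Notation mono := ('I_n -> nat).
Local Notation term := (R * mono)%type.
Implicit Types p q : seq term.

(** A common form for three readings of a polynomial: its complex value, its bound by absolute
    values, and the random weight attached to it. *)
Definition pl_map {C : comNzRingType} (h : R -> C) (v : mono -> C) p : C :=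
  \sum_(m <- p) h m.1 * v m.2.

Definition pl_one : seq term := [:: (1, fun=> 0)].

Definition pl_mul p q : seq term :=
  [seq (m.1 * m'.1, fun j => (m.2 j + m'.2 j)%N) | m <- p, m' <- q].

Definition pl_exp p k : seq term := iter k (pl_mul p) pl_one.

Lemma pl_map_exp {C : comNzRingType} (h : R -> C) (v : mono -> C) p k :
  {morph h : x y / x * y} -> h 1 = 1 -> v (fun=> 0%N) = 1 ->
  (forall a b, v (fun j => (a j + b j)%N) = v a * v b) ->
  pl_map h v (pl_exp p k) = pl_map h v p ^+ k.
Proof.
move=> hM h1 v0 vD; elim: k => [|k ih].
  by rewrite /pl_map big_seq1 /= h1 v0 mulr1.
rewrite exprS -ih /= /pl_map /pl_mul big_allpairs_dep mulr_suml.
apply: eq_bigr => m _; rewrite mulr_sumr; apply: eq_bigr => m' _ /=.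
by rewrite hM vD mulrACA.
Qed.

End term_lists.

(** * A random vector with a prescribed exponential factor *)

Section construction.
Context {R : realType} {n : nat}.
Local Notation term := (R * ('I_n -> nat))%type.
Variables (q : seq term) (eps : R).
Hypothesis eps_gt0 : 0 < eps.
Hypothesis q_small :
  pl_map (fun a => `|a|) (fun k => \prod_j eps ^+ k j) q <= 2^-1.

Hypothesis q0 : pl_map (real_complex R) (fun k => \prod_j 0 ^+ k j) q = 0.

Lemma exists_charfun_exp :
  exists (d : measure_display) (T : measurableType d) (P : probability T R)
    (X : 'I_n -> T -> R) (phi : R -> R[i]),
  [/\ forall j, measurable_fun setT (X j), phi 0 = 1 &
  forall t : 'I_n -> R, cf_of P (fun w => \sum_j t j * X j w) =
    (\prod_j phi (t j)) *
    cexp (pl_map (real_complex R)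
            (fun k => \prod_j (- 'i%C * (t j)%:C) ^+ k j) q)].
Proof.
have [d0 [T0 [P0 [X0 [r [mX0 mr br r0 rE]]]]]] := exists_bandlimited eps_gt0.
have [d [T [P [pr [mpr prE]]]]] := exists_iid P0 n.
pose phi s := wcf P0 (fun=> 1) (fun w => s * X0 w).
pose X j w := X0 (pr j w).
have mX j : measurable_fun setT (X j) by exact: measurableT_comp.
pose Y (t : 'I_n -> R) w := \sum_j t j * X j w.
have mY t : measurable_fun setT (Y t).
  by apply: measurable_sum => j; exact: measurable_funM.
pose eta := pl_map (fun a => `|a|) (fun k => \prod_j eps ^+ k j) q.
have eta0 : 0 <= eta.
  rewrite /eta /pl_map; apply: sumr_ge0 => m _; rewrite mulr_ge0// prodr_ge0// => j _.
  by rewrite exprn_ge0// ltW.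
pose ev (t : 'I_n -> R) := pl_map (real_complex R)
  (fun k => \prod_j (- 'i%C * (t j)%:C) ^+ k j).
(* The weight that replaces each monomial by a product of density ratios. By linearity and
   independence its transform is [ev t p] times the product of the [phi (t j)]. *)
pose L p w := pl_map idfun (fun k => \prod_j r (k j) (pr j w)) p.
have mmono (k : 'I_n -> nat) : measurable_fun setT (fun w => \prod_j r (k j) (pr j w)).
  by apply: measurable_prod => j _; exact: measurableT_comp.
have bmono (k : 'I_n -> nat) w :
    `|\prod_j r (k j) (pr j w)| <= \prod_j eps ^+ k j.
  by apply: norm_prod_le => j; exact: br.
have mL p : measurable_fun setT (L p).
  by apply: measurable_sum => m; exact: measurable_funM.
have bL p w : `|L p w| <= pl_map (fun a => `|a|) (fun k => \prod_j eps ^+ k j) p.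
  rewrite /L /pl_map (le_trans (ler_norm_sum _ _ _))// ler_sum// => m _.
  by rewrite normrM ler_wpM2l.
have LE p t : wcf P (L p) (Y t) = (\prod_j phi (t j)) * ev t p.
  elim: p => [|m p ih].
    rewrite /ev /pl_map big_nil mulr0.
    by rewrite (_ : L [::] = fun=> 0) ?wcf0//; apply/funext => w;
      rewrite /L /pl_map big_nil.
  have -> : L (m :: p) = fun w => m.1 * \prod_j r (m.2 j) (pr j w) + L p w.
    by apply/funext => w; rewrite /L /pl_map big_cons.
  have mm : measurable_fun setT (fun w => m.1 * \prod_j r (m.2 j) (pr j w)).
    exact: measurable_funM.
  have bm w : `|m.1 * \prod_j r (m.2 j) (pr j w)| <= `|m.1| * \prod_j eps ^+ m.2 j.
    by rewrite normrM ler_wpM2l.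
  rewrite (wcfD P (mY t) mm bm (mL p) (bL p)) ih.
  rewrite (wcfZ P (mY t) m.1 (mmono m.2) (bmono m.2)).
  rewrite /ev /pl_map big_cons mulrDr; congr (_ + _).
  have mY0 j : measurable_fun setT (fun w => t j * X0 w) by exact: measurable_funM.
  have := prE _ _ _ (fun j => mr (m.2 j)) (fun j => br (m.2 j)) mY0.
  rewrite /Y => ->; under eq_bigr do rewrite rE -/(phi _).
  rewrite big_split /= [RHS]mulrCA; congr (_ * _); exact: mulrC.
(* The power of [q] is expanded as a polynomial before [L] is applied: [r] is not multiplicative in
   its index, so [L] of a power differs in general from the power of [L]. *)
pose a k w := L (pl_exp q k) w / k`!%:R.
have ba k w : `|a k w| <= eta ^+ k.
  rewrite /a normrM normfV normr_nat.
  have -> : eta ^+ k =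
      pl_map (fun a => `|a|) (fun k => \prod_j eps ^+ k j) (pl_exp q k).
    rewrite (pl_map_exp (h := fun a : R => `|a|))//.
    - exact: normrM.
    - exact: normr1.
    - by under eq_bigr do rewrite expr0; rewrite big1.
    - by move=> b c; under eq_bigr do rewrite exprD; rewrite big_split.
  rewrite (le_trans _ (bL _ w))// ler_piMr// invf_le1 ?ltr0n ?fact_gt0//.
  by rewrite ler1n fact_gt0.
have a0 w : a 0 w = 1.
  rewrite /a fact0 divr1 /L /pl_map big_seq1/= mul1r big1// => j _; exact: r0.
pose S N w := \sum_(k < N) a k w.
have mS N : measurable_fun setT (S N).
  by apply: measurable_sum => k; exact: measurable_funM.
(* As [eta <= 1/2], the terms of positive index add up to at most 1 and cannot outweigh [a 0 = 1].
   This keeps the limit [h] nonnegative. *)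
have geo N : \sum_(k < N) eta ^+ k.+1 <= 1.
  apply: (@le_trans _ _ (\sum_(k < N) 2^-1 ^+ k.+1)).
    by apply: ler_sum => k _; rewrite lerXn2r ?nnegrE ?invr_ge0.
  have : \sum_(k < N) 2^-1 ^+ k.+1 = 1 - 2^-1 ^+ N :> R.
    elim: N => [|N ih]; first by rewrite big_ord0 expr0 subrr.
    by rewrite big_ord_recr/= ih exprS; field.
  by move=> ->; rewrite gerBl exprn_ge0// invr_ge0.
have S1 N w : `|S N.+1 w - 1| <= 1.
  rewrite /S big_ord_recl a0 addrAC subrr add0r.
  rewrite (le_trans (ler_norm_sum _ _ _))// (le_trans _ (geo N))//.
  by apply: ler_sum => k _; exact: ba.
have Sb N w : `|S N w| <= 2.
  case: N => [|N]; first by rewrite /S big_ord0 normr0.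
  have := S1 N w; rewrite !ler_norml; lra.
have cS w : cvgn (S ^~ w).
  have -> : S ^~ w = series (a ^~ w).
    by apply/funext => N; rewrite /S /series/= big_mkord.
  apply: normed_cvg; apply: (series_le_cvg (v_ := geometric 1 eta)).
  - by move=> k /=.
  - by move=> k /=; rewrite mul1r exprn_ge0.
  - by move=> k; rewrite /= mul1r; exact: ba.
  - apply: is_cvg_geometric_series; rewrite ger0_norm//.
    by rewrite (le_lt_trans q_small)// invf_lt1// ltr1n.
pose h w := lim (S ^~ w @ \oo).
have Sh w : S ^~ w @ \oo --> h w by exact: cS.
have mh : measurable_fun setT h.
  by apply: (@measurable_fun_cvg _ _ _ setT S) => // w _; exact: Sh.
have h_ge0 w : 0 <= h w.
  apply: limr_ge; first exact: cS.
  exists 1 => // N /=; case: N => // N _.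
  have := S1 N w; rewrite ler_norml; lra.
have h_le2 w : `|h w| <= 2.
  rewrite ger0_norm//; apply: limr_le; first exact: cS.
  by apply: nearW => N; rewrite (le_trans (ler_norm _))// Sb.
have hE t : wcf P h (Y t) = (\prod_j phi (t j)) * cexp (ev t q).
  (* The partial sums have exactly the partial sums of the exponential series as transforms; both
     sides then pass to the limit, the left one by dominated convergence with the bound 2. *)
  have SE N : wcf P (S N) (Y t) = (\prod_j phi (t j)) * texp (ev t q) N.
    elim: N => [|N ih].
      rewrite /texp big_ord0 mulr0.
      by rewrite (_ : S 0 = fun=> 0) ?wcf0//; apply/funext => w; rewrite /S big_ord0.
    have -> : S N.+1 = fun w => S N w + (N`!%:R)^-1 * L (pl_exp q N) w.
      by apply/funext => w; rewrite /S big_ord_recr /= /a [_ / _]mulrC.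
    pose p := pl_exp q N.
    have mp : measurable_fun setT (fun w => (N`!%:R)^-1 * L p w).
      exact: measurable_funM.
    have bp w : `|(N`!%:R)^-1 * L p w| <= `|(N`!%:R)^-1| *
        pl_map (fun a => `|a|) (fun k => \prod_j eps ^+ k j) p.
      by rewrite normrM ler_wpM2l.
    rewrite (wcfD P (mY t) (mS N) (Sb N) mp bp) ih.
    rewrite (wcfZ P (mY t) _ (mL p) (bL p)) LE /texp big_ord_recr/= mulrDr.
    congr (_ + _); rewrite mulrCA; congr (_ * _); rewrite mulrC /p /ev pl_map_exp.
    - by rewrite fmorphV rmorph_nat.
    - exact: rmorphM.
    - by [].
    - by under eq_bigr do rewrite expr0; rewrite big1.
    - by move=> b c; under eq_bigr do rewrite exprD; rewrite big_split.
  set z := ev t q in SE *; set c := \prod_j phi (t j) in SE *.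
  have [cre cim] := cexp_texp_cvg z.
  have lim_re : complex.Re (wcf P (S N) (Y t)) @[N --> \oo] --> complex.Re (c * cexp z).
    under eq_fun do rewrite SE.
    case: (c) (cexp z) cre cim => c1 c2 [e1 e2] /= cre cim.
    rewrite (_ : (fun N => _) = (fun N => c1 * complex.Re (texp z N)
      - c2 * complex.Im (texp z N))); last first.
      by apply/funext => N; case: (texp z N).
    by apply: cvgB; apply: cvgMr.
  have lim_im : complex.Im (wcf P (S N) (Y t)) @[N --> \oo] --> complex.Im (c * cexp z).
    under eq_fun do rewrite SE.
    case: (c) (cexp z) cre cim => c1 c2 [e1 e2] /= cre cim.
    rewrite (_ : (fun N => _) = (fun N => c1 * complex.Im (texp z N)
      + c2 * complex.Re (texp z N))); last first.
      by apply/funext => N; case: (texp z N).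
    by apply: cvgD; apply: cvgMr.
  have i2 : P.-integrable setT (EFin \o cst 2).
    exact: finite_measure_integrable_cst.
  have wre : complex.Re (wcf P (S N) (Y t)) @[N --> \oo] --> complex.Re (wcf P h (Y t)).
    apply: (Rintegral_cvg _ _ _ i2) => //.
    - by move=> N; apply: measurable_funM => //; exact: measurable_cosT.
    - by apply: measurable_funM => //; exact: measurable_cosT.
    - by move=> w; apply: cvgMl; exact: Sh.
    - by move=> N w; rewrite normM_le1// norm_cos_le1.
  have wim : complex.Im (wcf P (S N) (Y t)) @[N --> \oo] --> complex.Im (wcf P h (Y t)).
    apply: (Rintegral_cvg _ _ _ i2) => //.
    - by move=> N; apply: measurable_funM => //; exact: measurable_sinT.
    - by apply: measurable_funM => //; exact: measurable_sinT.
    - by move=> w; apply: cvgMl; exact: Sh.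
    - by move=> N w; rewrite normM_le1// norm_sin_le1.
  apply/eqP; rewrite eq_complex; apply/andP; split; apply/eqP.
  - by rewrite -(cvg_lim _ wre)// (cvg_lim _ lim_re).
  - by rewrite -(cvg_lim _ wim)// (cvg_lim _ lim_im).
have phi0 : phi 0 = 1.
  rewrite /phi /wcf; under eq_Rintegral do rewrite mul0r cos0 mulr1.
  under [X in Complex _ X]eq_Rintegral do rewrite mul0r sin0 mulr0.
  by rewrite !Rintegral_probability_cst.
have int_h : P.-integrable setT (EFin \o h) by exact: integrable_bounded mh h_le2.
have Y0 w : Y (fun=> 0) w = 0 by rewrite /Y big1// => j _; rewrite mul0r.
(* The total mass is the transform at [t = 0], where [q] vanishes. *)
have h1 : (\int[P]_w (h w)%:E = 1)%E.
  have := hE (fun=> 0).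
  rewrite (_ : ev (fun=> 0) q = 0); last first.
    by rewrite -[RHS]q0 /ev; congr pl_map; apply/funext => k;
      apply: eq_bigr => j _; rewrite mulr0.
  rewrite [X in _ = X * _]big1 => [|j _]; last exact: phi0.
  rewrite mul1r /= expR0 cos0 sin0 mulr1 mulr0 => -[+ _].
  under eq_Rintegral do rewrite Y0 cos0 mulr1.
  rewrite /Rintegral => h1.
  by rewrite -[LHS]fineK ?h1//; exact: integrable_fin_num.
have [P' P'E] := exists_density h_ge0 int_h h1.
exists d, T, P', X, phi; split=> // t; rewrite -/(ev t q) -hE.
have mc := measurable_cosT (mY t); have ms := measurable_sinT (mY t).
rewrite /cf_of /wcf (P'E _ 1 mc (fun=> norm_cos_le1 _)).
rewrite (P'E _ 1 ms (fun=> norm_sin_le1 _)).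
by congr Complex; apply: eq_Rintegral => w _; rewrite mulrC.
Qed.

End construction.

(** * Polynomials determined by grids, their restriction to axes, and their size near 0 *)

Section polynomial_identity.
Context {R : realType} {n D : nat}.
Local Notation midx := {ffun 'I_n -> 'I_D.+1}.
Implicit Types (a b : midx -> R[i]) (k : midx).

(* Invert the Vandermonde matrix of the nodes in each variable separately. *)
Lemma mpoly_eval_grid_eq0 a (x : 'I_D.+1 -> R) : injective x ->
  (forall s : midx, mpoly_eval a (fun j => x (s j)) = 0) -> forall k, a k = 0.
Proof.
move=> xI a0 k.
pose V : 'M[R[i]]_D.+1 := Vandermonde D.+1 (\row_i (x i)%:C).
have Vu : V \in unitmx.
  rewrite unitmxE det_Vandermonde unitfE prodf_seq_neq0; apply/allP => i _ /=.
  rewrite prodf_seq_neq0; apply/allP => j _; apply/implyP => ij.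
  rewrite !mxE subr_eq0 (inj_eq (@complexI _)) (inj_eq xI).
  by apply: contraTneq ij => ->; rewrite ltnn.
pose W := invmx V.
have VW (i l : 'I_D.+1) : \sum_s (x s)%:C ^+ i * W s l = (i == l)%:R.
  have := mulmxV Vu => /matrixP/(_ i l); rewrite !mxE => <-.
  by apply: eq_bigr => s _; rewrite !mxE.
have : \sum_(s : midx) mpoly_eval a (fun j => x (s j)) * \prod_j W (s j) (k j) = 0.
  by rewrite big1// => s _; rewrite a0 mul0r.
rewrite /mpoly_eval.
under eq_bigr do rewrite mulr_suml; rewrite exchange_big/=.
under eq_bigr => i _.
  under eq_bigr => s _ do rewrite -mulrA -big_split/=.
  rewrite -mulr_sumr -(bigA_distr_bigA (fun j s => (x s)%:C ^+ i j * W s (k j)))/=.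
  under eq_bigr do rewrite VW.
  over.
rewrite (bigD1 k)//= [X in _ * X]big1 => [|j _]; last by rewrite eqxx.
rewrite mulr1 [X in _ + X]big1 ?addr0// => i ik.
have [j ij] : exists j, i j != k j.
  apply/existsP; rewrite -negb_forall; apply: contra ik => /forallP h.
  by apply/eqP/ffunP => j; apply/eqP.
by rewrite (bigD1 j)//= (negbTE ij) mul0r mulr0.
Qed.

Lemma multideg_eq0 k : multideg k = 0%N -> k = [ffun => ord0].
Proof.
move=> /eqP; rewrite sum_nat_eq0 => /forallP h; apply/ffunP => j.
by apply/val_inj/eqP; rewrite ffunE; exact: h.
Qed.

Lemma mpoly_eval_scale_sign a (t : 'I_n -> R) :
  mpoly_eval a (fun j => - t j) =
  mpoly_eval (fun k => (-1) ^+ multideg k * a k) t.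
Proof.
apply: eq_bigr => k _; rewrite mulrAC mulrC; congr (_ * _).
rewrite /multideg -prodrXr mulrC -big_split/=; apply: eq_bigr => j _.
by rewrite rmorphN [LHS]exprNn mulrC.
Qed.

Lemma mpoly_eval_conj a (t : 'I_n -> R) :
  conjc (mpoly_eval a t) = mpoly_eval (fun k => conjc (a k)) t.
Proof.
rewrite /mpoly_eval rmorph_sum; apply: eq_bigr => k _.
rewrite rmorphM rmorph_prod; congr (_ * _); apply: eq_bigr => j _.
by rewrite rmorphXn; congr (_ ^+ _); exact: conjc_real.
Qed.

Definition axis (j : 'I_n) (s : R) (l : 'I_n) : R := if l == j then s else 0.

(** The restriction of the polynomial to an axis, kept as a polynomial in all variables so that the
    vanishing criterion on grids applies to it. *)
Definition axis_coef a (j : 'I_n) k : R[i] :=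
  if [forall l, (l != j) ==> (k l == ord0)] then a k else 0.

Lemma mpoly_eval_axis a (j : 'I_n) (t : 'I_n -> R) :
  mpoly_eval a (axis j (t j)) = mpoly_eval (axis_coef a j) t.
Proof.
apply: eq_bigr => k _; rewrite /axis_coef; case: ifPn => [/forallP h|].
  congr (_ * _); apply: eq_bigr => l _; rewrite /axis.
  by have := h l; case: eqP => [->//|_ /= /eqP ->]; rewrite !expr0.
rewrite negb_forall => /existsP[l]; rewrite negb_imply => /andP[lj kl].
have kl0 : (nat_of_ord (k l) == 0%N) = false by exact: negbTE.
rewrite (bigD1 l)//= /axis (negbTE lj) (_ : 0%:C ^+ k l = 0 :> R[i]).
  by rewrite mul0r mulr0 mul0r.
by rewrite rmorph0 expr0n kl0.
Qed.

Lemma axis_coef_eq0 a (j : 'I_n) : a [ffun => ord0] = 0 ->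
  (forall k, #|[set l | nat_of_ord (k l) != 0%N]%SET| = 1%N -> a k = 0) ->
  forall k, axis_coef a j k = 0.
Proof.
move=> a0 a1 k; rewrite /axis_coef; case: ifPn => // /forallP h.
have [kj|kj] := eqVneq (k j) ord0.
  rewrite (_ : k = [ffun => ord0])//; apply/ffunP => l; rewrite ffunE.
  by have := h l; case: eqP => [->//|_ /= /eqP].
apply: a1; rewrite (_ : [set _ | _]%SET = [set j]%SET) ?cards1//.
apply/setP => l; rewrite !inE; have := h l.
by case: eqP => [->|_ /= /eqP ->].
Qed.

(** Without constant term, every monomial has at least one factor of size at most [e], and the other
    factors are at most 1. *)
Lemma mpoly_eval_bound a (t : 'I_n -> R) (e : R) : a [ffun => ord0] = 0 ->
  0 <= e <= 1 -> (forall j, `|t j| <= e) ->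
  `|mpoly_eval a t| <= (\sum_k `|a k|) * e%:C.
Proof.
move=> a0 /andP[e0 e1] te.
rewrite /mpoly_eval (le_trans (ler_norm_sum _ _ _))// mulr_suml ler_sum// => k _.
have [k0|k0] := eqVneq (multideg k) 0%N.
  by rewrite (multideg_eq0 k0) a0 !mul0r normr0 mul0r.
rewrite normrM ler_wpM2l//.
have nr (u : R) : `|u%:C| = `|u|%:C by rewrite normc_def/= expr0n addr0 sqrtr_sqr.
rewrite normr_prod; under eq_bigr do rewrite normrX nr -rmorphXn.
rewrite -rmorph_prod lecR.
apply: (@le_trans _ _ (\prod_(j < n) e ^+ k j)).
  by apply: ler_prod => j _; rewrite exprn_ge0//= lerXn2r ?nnegrE.
rewrite prodrXr -/(multideg k); case: (multideg k) k0 => // m _.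
by rewrite exprS ler_piMr// exprn_ile1.
Qed.

End polynomial_identity.

(** * Injectivity of [cexp] on a strip *)

Section complex_exponential_injectivity.
Context {R : realType}.
Implicit Types z w : R[i].

Lemma cexp_conj z : cexp (conjc z) = conjc (cexp z).
Proof. by case: z => a b /=; rewrite cosN sinN mulrN. Qed.

Lemma cexp0 : cexp (0 : R[i]) = 1.
Proof. by rewrite /= expR0 cos0 sin0 mulr1 mulr0. Qed.

(** The moduli determine the real parts; the imaginary parts lie in [[-pi/2, pi/2]], where the sine
    is injective. *)
Lemma cexp_inj_small z w : `|complex.Im z| < 1 -> `|complex.Im w| < 1 ->
  cexp z = cexp w -> z = w.
Proof.
case: z w => [x y] [x' y'] /= y1 y1' [ec es].
have e2 : expR x ^+ 2 = expR x' ^+ 2.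
  rewrite -[LHS]mulr1 -[RHS]mulr1 -{1}(cos2Dsin2 y) -(cos2Dsin2 y').
  by rewrite !mulrDr -!exprMn ec es.
have ex : expR x = expR x'.
  by apply/eqP; rewrite -(eqrXn2 (n := 2)) ?expR_ge0//; apply/eqP.
have xx : x = x' by exact: expR_inj.
have sy : sin y = sin y'.
  by apply: (mulfI (lt0r_neq0 (expR_gt0 x))); rewrite es ex.
congr Complex => //; apply: sin_inj sy; rewrite in_itv/= -ler_norml.
- rewrite (le_trans (ltW y1))// ler_pdivlMr// mul1r; exact: pi_ge2.
- rewrite (le_trans (ltW y1'))// ler_pdivlMr// mul1r; exact: pi_ge2.
Qed.

End complex_exponential_injectivity.

(** * Symmetry, axes and nonvanishing of characteristic functions *)

Section characteristic_functions.
Context {d : measure_display} {T : measurableType d} {R : realType}.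
Variable P : probability T R.

Lemma cf_ofN (Y : T -> R) : measurable_fun setT Y ->
  cf_of P (fun w => - Y w) = conjc (cf_of P Y).
Proof.
move=> mY; rewrite /cf_of /=; congr Complex.
  by apply: eq_Rintegral => w _; rewrite cosN.
rewrite -mulN1r -RintegralZl//; last first.
  apply: (@integrable_bounded _ _ _ P _ 1); first exact: measurable_sinT.
  by move=> w; exact: norm_sin_le1.
by apply: eq_Rintegral => w _; rewrite sinN mulN1r.
Qed.

Lemma charfunN (X : {RV P >-> R}) s : charfun X (- s) = conjc (charfun X s).
Proof.
rewrite -cf_ofN; last exact: measurable_funM.
by congr cf_of; apply/funext => w; rewrite mulNr.
Qed.

Lemma charfun0 (X : {RV P >-> R}) : charfun X 0 = 1.
Proof.
rewrite /charfun /cf_of; under eq_Rintegral do rewrite mul0r cos0.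
under [X in Complex _ X]eq_Rintegral do rewrite mul0r sin0.
by rewrite !Rintegral_probability_cst.
Qed.

Lemma charfun_vecN n (X : 'I_n -> {RV P >-> R}) t :
  charfun_vec X (fun j => - t j) = conjc (charfun_vec X t).
Proof.
rewrite -cf_ofN; last by apply: measurable_sum => j; exact: measurable_funM.
by congr cf_of; apply/funext => w; rewrite -sumrN; apply: eq_bigr => j _; rewrite mulNr.
Qed.

Lemma charfun_vec_axis n (X : 'I_n -> {RV P >-> R}) (j : 'I_n) s :
  charfun_vec X (axis j s) = charfun (X j) s.
Proof.
congr cf_of; apply/funext => w; rewrite (bigD1 j)//= /axis eqxx big1 ?addr0// => l lj.
by rewrite (negbTE lj) mul0r.
Qed.

(** By dominated convergence the real part tends to 1 along [1 / (m + 1)]; a sequence is enough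
    because the grid nodes are taken from it. *)
Lemma charfun_neq0_near (X : {RV P >-> R}) :
  \forall m \near \oo, charfun X (m.+1%:R^-1) != 0.
Proof.
have c : complex.Re (charfun X (m.+1%:R^-1)) @[m --> \oo] --> (1 : R).
  rewrite -[X in _ --> X](Rintegral_probability_cst P).
  have i1 : P.-integrable setT (EFin \o cst 1).
    exact: finite_measure_integrable_cst.
  apply: (Rintegral_cvg _ _ _ i1) => //.
  - by move=> m; apply: measurable_cosT; exact: measurable_funM.
  - move=> w.
    have c0 : m.+1%:R^-1 * X w @[m --> \oo] --> (0 : R).
      by rewrite -(mul0r (X w)); apply: cvgMl; exact: cvg_harmonic.
    rewrite -[X in _ --> X]cos0; exact: (continuous_cvg _ (@continuous_cos R 0) c0).
  - by move=> m w; exact: norm_cos_le1.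
have [N _ hN] := cvgr_gt _ c _ ltr01; exists N => // m Nm.
by have := hN m Nm; apply: contraTneq => ->; rewrite ltxx.
Qed.

End characteristic_functions.

(** * Necessity of the two conditions *)

Section necessity.
Context {R : realType} {n D : nat}.
Local Notation midx := {ffun 'I_n -> 'I_D.+1}.
Variables (a : midx -> R[i]) (a0 : a [ffun => ord0] = 0).
Context {d : measure_display} {T : measurableType d} (P : probability T R)
  (X : 'I_n -> {RV P >-> R}).
Hypothesis XE : forall t : 'I_n -> R, charfun_vec X t =
  (\prod_(j < n) charfun (X j) (t j)) * cexp (mpoly_eval a t).

(** Nodes so close to 0 that no [charfun (X j)] vanishes there and [cexp] can be inverted at the
    values of [q]. The last clause bounds [|t j|] only, so that it also covers reflected grid points
    and points on the axes. *)
Let grid : exists x : 'I_D.+1 -> R, [/\ injective x,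
  forall i, 0 < x i, forall j i, charfun (X j) (x i) != 0 &
  forall t : 'I_n -> R, (forall j, exists i, `|t j| <= x i) ->
    `|complex.Im (mpoly_eval a t)| < 1].
Proof.
pose A : R := complex.Re (\sum_k `|a k|).
have AE : \sum_k `|a k| = A%:C.
  by rewrite RRe_real// rpred_sum// => k _; exact: normr_real.
have A0 : 0 <= A by rewrite -lecR -AE sumr_ge0.
have /choice[N hN] : forall j, exists N : nat, forall m, (N <= m)%N ->
    charfun (X j) (m.+1%:R^-1) != 0.
  by move=> j; have [N _ h] := charfun_neq0_near (X j); exists N.
(* The first entry secures nonvanishing for all [j]; the second makes [A / (M + 1) < 1]. *)
pose M := maxn (\max_j N j) (Num.truncn A).+1.
pose x (i : 'I_D.+1) : R := (M + i).+1%:R^-1.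
have x0 i : 0 < x i by rewrite invr_gt0.
have xM i : x i <= M.+1%:R^-1.
  by rewrite lef_pV2 ?posrE// ler_nat ltnS leq_addr.
exists x; split => //.
- move=> i i' /invr_inj/eqP; rewrite eqr_nat eqSS eqn_add2l => /eqP.
  exact: val_inj.
- move=> j i; apply: hN; rewrite (leq_trans _ (leq_addr _ _))//.
  by rewrite (leq_trans _ (leq_maxl _ _))// leq_bigmax.
- move=> t tx.
  have tM j : `|t j| <= M.+1%:R^-1.
    by have [i ti] := tx j; rewrite (le_trans ti).
  have e01 : 0 <= (M.+1%:R^-1 : R) <= 1 by rewrite invr_ge0 invf_le1//= ler0n ler1n.
  have := mpoly_eval_bound a0 e01 tM; rewrite AE -rmorphM => h.
  rewrite -ltcR (le_lt_trans (normc_ge_Im _))// (le_lt_trans h)// ltcR.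
  rewrite ltr_pdivrMr// mul1r (lt_le_trans (truncnS_gt A))// ler_nat.
  by rewrite (leq_trans (leq_maxr (\max_j N j) _)).
Qed.

Lemma necessary_axis (k : midx) :
  #|[set j | nat_of_ord (k j) != 0%N]%SET| = 1%N -> a k = 0.
Proof.
move=> /eqP/cards1P[j kj]; have [x [xI xp x0 xs]] := grid.
have := mpoly_eval_grid_eq0 (a := axis_coef a j) xI _ k.
rewrite /axis_coef ifT; last first.
  apply/forallP => l; apply/implyP => lj.
  have : l \notin [set j]%SET by rewrite inE.
  by rewrite -kj inE negbK.
apply => s; rewrite -(mpoly_eval_axis a j (fun j => x (s j))).
have small : `|complex.Im (mpoly_eval a (axis j (x (s j))))| < 1.
  apply: xs => l; exists (s j); rewrite /axis.
  by case: eqP => _; [rewrite gtr0_norm|rewrite normr0 ltW].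
(* On the axis both sides contain the nonzero factor [charfun (X j)] and the other factors are 1, so
   [cexp] of the polynomial is 1. *)
have /esym := XE (axis j (x (s j))); rewrite charfun_vec_axis.
rewrite (bigD1 j)//= big1 => [|l lj]; last first.
  by rewrite /axis (negbTE lj) charfun0.
rewrite /axis eqxx mulr1 => /(canRL (mulKf (x0 _ _))); rewrite mulVf// => h.
apply: cexp_inj_small => //=; first by rewrite normr0.
by rewrite [RHS]cexp0.
Qed.

Lemma necessary_parity (k : midx) :
  if odd (multideg k) then cRe (a k) = 0 else cIm (a k) = 0.
Proof.
have [x [xI xp x0 xs]] := grid.
(* The coefficients of [q (- t) - conj (q t)]; their vanishing says that [a k] is real or purely
   imaginary according to the parity of the degree. *)
pose b (k : midx) := (-1) ^+ multideg k * a k - conjc (a k).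
have : b k = 0.
  apply: (mpoly_eval_grid_eq0 xI) => s.
  pose t j := x (s j).
  have -> : mpoly_eval b t = mpoly_eval a (fun j => - t j) - conjc (mpoly_eval a t).
    rewrite mpoly_eval_scale_sign mpoly_eval_conj /mpoly_eval -sumrB.
    by apply: eq_bigr => i _; rewrite -mulrBl.
  apply/eqP; rewrite subr_eq0; apply/eqP.
  have c0 : conjc (\prod_(j < n) charfun (X j) (t j)) != 0.
    by rewrite conjc_eq0; apply/prodf_neq0 => j _; exact: x0.
  apply: cexp_inj_small.
  - by apply: xs => j; exists (s j); rewrite /t normrN gtr0_norm.
  - have imJ (z : R[i]) : complex.Im (conjc z) = - complex.Im z by case: z.
    by rewrite imJ normrN; apply: xs => j; exists (s j); rewrite /t gtr0_norm.
  have vecJ : conjc (charfun_vec X t) = conjc (\prod_(j < n) charfun (X j) (t j)) *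
      conjc (cexp (mpoly_eval a t)) by rewrite XE; exact: rmorphM.
  rewrite cexp_conj; apply: (mulfI c0); rewrite -vecJ -charfun_vecN XE.
  congr (_ * _); rewrite rmorph_prod; apply: eq_bigr => j _.
  by rewrite [RHS]charfunN.
rewrite /b -signr_odd; case: (a k) => u v; case: (odd _) => /=.
  by rewrite expr1 mulN1r => -[h _]; lra.
by rewrite expr0 mul1r => -[_ h]; lra.
Qed.

End necessity.

(** * Sufficiency of the two conditions *)

Section sufficiency.
Context {R : realType} {n D : nat}.
Local Notation midx := {ffun 'I_n -> 'I_D.+1}.
Variables (a : midx -> R[i]) (a0 : a [ffun => ord0] = 0).
Hypothesis n_ge1 : (1 <= n)%N.
Hypothesis a_axis : forall k : midx,
  #|[set j | nat_of_ord (k j) != 0%N]%SET| = 1%N -> a k = 0.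
Hypothesis a_parity : forall k : midx,
  if odd (multideg k) then cRe (a k) = 0 else cIm (a k) = 0.

(** The coefficients of [q] as a polynomial in the [- i t_j]. The parity condition makes
    [a k * i^(deg k)] real, so nothing is lost by taking the real part. *)
Let alpha (k : midx) : R := complex.Re (a k * 'i%C ^+ multideg k).

Let alphaE k : a k = (alpha k)%:C * (- 'i%C) ^+ multideg k.
Proof.
have -> : (alpha k)%:C = a k * 'i%C ^+ multideg k.
  rewrite /alpha; have := a_parity k; rewrite -(odd_double_half (multideg k)).
  move: (_./2) => m; rewrite oddD odd_double addbF oddb exprD -mul2n exprM sqr_i.
  have -> : (-1) ^+ m = ((-1) ^+ m)%:C :> R[i] by rewrite rmorphXn rmorphN1.
  case: (odd _) (a k) => -[u v] /= ->; rewrite ?expr1 ?expr0; by simpc.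
rewrite -mulrA -exprMn mulrN -expr2 sqr_i opprK expr1n mulr1//.
Qed.

Let q := [seq (alpha k, fun j => nat_of_ord (k j)) | k <- index_enum midx].

Let q_eval (t : 'I_n -> R) : pl_map (real_complex R)
  (fun k => \prod_j (- 'i%C * (t j)%:C) ^+ k j) q = mpoly_eval a t.
Proof.
rewrite /pl_map big_map /mpoly_eval; apply: eq_bigr => k _ /=.
rewrite alphaE -mulrA; congr (_ * _); rewrite /multideg -prodrXr -big_split/=.
by apply: eq_bigr => j _; rewrite exprMn.
Qed.

Let eval_axis j s : mpoly_eval a (axis j s) = 0.
Proof.
rewrite (mpoly_eval_axis a j (fun=> s)) /mpoly_eval big1// => k _.
by rewrite (axis_coef_eq0 j a0 a_axis) mul0r.
Qed.

Lemma sufficient :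
  exists (d : measure_display) (T : measurableType d) (P : probability T R)
         (X : 'I_n -> {RV P >-> R}),
    forall t : 'I_n -> R, charfun_vec X t =
      (\prod_(j < n) charfun (X j) (t j)) * cexp (mpoly_eval a t).
Proof.
pose A : R := \sum_k `|alpha k|.
have A0 : 0 <= A by exact: sumr_ge0.
(* Chosen so that [eps <= 1] and [A * eps <= 1/2]: every term of [q] with nonzero coefficient has
   positive degree and so contributes at least one factor [eps]. *)
pose eps : R := (2 * (1 + A))^-1.
have eps0 : 0 < eps by rewrite invr_gt0 mulr_gt0// ltr_wpDr.
have eps1 : eps <= 1 by rewrite invf_le1 ?mulr_gt0 ?ltr_wpDr//; lra.
have small : pl_map (fun a => `|a|) (fun k => \prod_j eps ^+ k j) q <= 2^-1.
  rewrite /pl_map big_map; apply: (@le_trans _ _ (A * eps)).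
    rewrite /A mulr_suml; apply: ler_sum => k _ /=.
    have [k0|k0] := eqVneq (multideg k) 0%N.
      by rewrite /alpha (multideg_eq0 k0) a0 !mul0r normr0 !mul0r.
    rewrite ler_wpM2l// prodrXr -/(multideg k); case: (multideg k) k0 => // m _.
    by rewrite exprS ler_piMr ?(ltW eps0)// exprn_ile1// ltW.
  rewrite /eps invfM mulrCA ler_piMr ?invr_ge0// ler_pdivrMr ?ltr_wpDr//; lra.
have q0 : pl_map (real_complex R) (fun k => \prod_j 0 ^+ k j) q = 0.
  rewrite -[RHS](eval_axis (Ordinal n_ge1) 0) -q_eval; congr pl_map.
  apply/funext => k; apply: eq_bigr => j _; rewrite /axis.
  by case: ifP => _; rewrite mulr0.
have [d [T [P [X [phi [mX phi0 XE]]]]]] := exists_charfun_exp eps0 small q0.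
pose Y j : {RV P >-> R} := mfun_Sub (mem_set (mX j)).
have YE t : charfun_vec Y t = (\prod_j phi (t j)) * cexp (mpoly_eval a t).
  by rewrite -q_eval -XE.
(* Along an axis [q] vanishes by condition (i) and the other factors are [phi 0 = 1], which
   identifies [phi] as the characteristic function of each component. *)
have phiE j s : charfun (Y j) s = phi s.
  rewrite -charfun_vec_axis YE eval_axis cexp0 mulr1 (bigD1 j)//= big1 => [|l lj].
    by rewrite /axis eqxx mulr1.
  by rewrite /axis (negbTE lj) phi0.
exists d, T, P, Y => t; rewrite YE; congr (_ * _).
by apply: eq_bigr => j _; rewrite phiE.
Qed.

End sufficiency.

Local Close Scope classical_set_scope.
Unset Implicit Arguments.

Theorem theorem1 (R : realType) (n : nat) (n_ge1 : (1 <= n)%N) (D : nat)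
  (a : {ffun 'I_n -> 'I_D.+1} -> R[i])
  (a0 : a [ffun => ord0] = 0) :
  (exists (d : measure_display) (T : measurableType d) (P : probability T R)
          (X : 'I_n -> {RV P >-> R}),
     forall t : 'I_n -> R,
       charfun_vec X t =
       (\prod_(j < n) charfun (X j) (t j)) * cexp (mpoly_eval a t))
  <->
  ((forall k : {ffun 'I_n -> 'I_D.+1},
      #|[set j | nat_of_ord (k j) != 0%N]| = 1%N -> a k = 0)
   /\
   (forall k : {ffun 'I_n -> 'I_D.+1},
      if odd (multideg k) then cRe (a k) = 0 else cIm (a k) = 0)).
Proof.
split=> [[d [T [P [X XE]]]]|[a_axis a_parity]].
  by split=> k; [exact: (necessary_axis a0 XE)|exact: (necessary_parity a0 XE)].
exact: sufficient.
Qed.
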